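(* Let $m,n\ge1$ be integers, let $G_{ij}=\frac1n$ for all $1\le i,j\le n$, and let $r_1,\ldots,r_n:\{0,1,2,\ldots\}\to[0,\infty)$ be rate functions with $r_i(0)=0$ and $r_i(k)>0$ for all $i\in\{1,\dots,n\}$ and $k\ge1$, such that for some constants $\delta,\Delta>0$, $$\delta\ \le\ r_i(k+1)-r_i(k)\ \le\ \Delta\qquad\text{for all } i\in\{1,\dots,n\}\text{ and all integers }k\ge0.$$ Then the log-Sobolev constant $t_{\mathrm{LS}}$ of the Zero-Range Process with $m$ particles, $n$ sites, geometry $G$ and rates $(r_i)_{1\le i\le n}$ satisfies $$t_{\mathrm{LS}}\ \le\ \frac{40\,\Delta}{\delta^2}\log\left(\frac{\Delta mn}{\delta}\right).$$
   Context: The Zero-Range Process with these parameters is the continuous-time Markov chain on $\mathcal X=\{x=(x_1,\ldots,x_n)\in\mathbb Z_+^n:\sum_{i=1}^n x_i=m\}$ with generator $$(Qf)(x)=\sum_{1\le i,j\le n} r_i(x_i)\,G_{ij}\left(f(x+\delta_j-\delta_i)-f(x)\right),$$ where $(\delta_1,\ldots,\delta_n)$ is the canonical basis of $\mathbb R^n$ (terms with $x_i=0$ vanish since $r_i(0)=0$). It is reversible with respect to the probability measure $\pi(x)\propto\prod_{i=1}^n\prod_{k=1}^{x_i}\frac1{r_i(k)}$ on $\mathcal X$. For a generator $Q$ on a finite set $\mathcal X$ reversible with respect to a probability measure $\pi$, let $\mathcal E(f,g)=\frac12\sum_{x,y\in\mathcal X}\pi(x)Q(x,y)(f(x)-f(y))(g(x)-g(y))$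 and, for $f:\mathcal X\to(0,\infty)$, $\mathrm{Ent}(f)=\mathbf E[f\log f]-\mathbf E[f]\log\mathbf E[f]$, with $\mathbf E$ the expectation under $\pi$ and $\log$ natural. The log-Sobolev constant $t_{\mathrm{LS}}$ is the smallest $t\ge0$ such that $\mathrm{Ent}(f)\le t\,\mathcal E(\sqrt f,\sqrt f)$ for all $f:\mathcal X\to(0,\infty)$. *)

(* Defs.v *)
From HB Require Import structures.
From mathcomp Require Import all_boot all_order all_algebra.
From mathcomp Require Import reals exp.

Set Implicit Arguments.
Unset Strict Implicit.
Unset Printing Implicit Defensive.

Import Order.TTheory GRing.Theory Num.Theory.
Local Open Scope ring_scope.

Section FiniteChain.
Variables (R : realType) (T : finType).

(* [Q x y] as the coefficient of [f y] in [(L f) x]. *)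
Definition kernel_of (L : (T -> R) -> T -> R) (x y : T) : R :=
  L (fun z => (z == y)%:R) x.

Definition dirichlet (Q : T -> T -> R) (pi : T -> R) (f g : T -> R) : R :=
  2^-1 * \sum_x \sum_y pi x * Q x y * (f x - f y) * (g x - g y).

Definition mean (pi : T -> R) (f : T -> R) : R := \sum_x pi x * f x.

Definition entropy (pi : T -> R) (f : T -> R) : R :=
  mean pi (fun x => f x * ln (f x)) - mean pi f * ln (mean pi f).

Definition log_sobolev_ineq (Q : T -> T -> R) (pi : T -> R) (t : R) : Prop :=
  forall f : T -> R, (forall x, 0 < f x) ->
    entropy pi f
      <= t * dirichlet Q pi (fun x => Num.sqrt (f x)) (fun x => Num.sqrt (f x)).

Definition is_log_sobolev_constant (Q : T -> T -> R) (pi : T -> R) (t : R) :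
    Prop :=
  [/\ 0 <= t, log_sobolev_ineq Q pi t &
      forall s, 0 <= s -> log_sobolev_ineq Q pi s -> t <= s].

End FiniteChain.

Section ZeroRange.
Variables (R : realType) (m n : nat).

(* Each coordinate of a configuration is at most [m], so bounding coordinates
   by ['I_m.+1] loses nothing and makes the state space a [finType]. *)
Definition zrp_state : Type :=
  {x : {ffun 'I_n -> 'I_m.+1} | (\sum_(i < n) x i)%N == m}.

Definition occ (x : zrp_state) (i : 'I_n) : nat := val x i.

(* x + delta_j - delta_i. If i is empty and i <> j this is not a configuration,
   and the value defaults to x. *)
Definition zrp_move (x : zrp_state) (i j : 'I_n) : zrp_state :=
  insubd x [ffun k => inord (occ x k + (k == j) - (k == i))%N].

Lemma occ_zrp_move (x : zrp_state) (i j k : 'I_n) : (0 < occ x i)%N ->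
  (occ (zrp_move x i j) k + (k == i) = occ x k + (k == j))%N.
Proof.
move=> xi_gt0.
have sumx : (\sum_(l < n) occ x l = m)%N by exact: eqP (valP x).
have sum1 (a : 'I_n) : (\sum_(l < n) (l == a) = 1)%N.
  by rewrite (bigD1 a) //= eqxx big1 // => l /negPf ->.
have le_i l : ((l == i) <= occ x l + (l == j))%N.
  by case: eqP => // ->; apply: leq_trans xi_gt0 (leq_addr _ _).
pose y l := (occ x l + (l == j) - (l == i))%N.
have yE l : (y l + (l == i) = occ x l + (l == j))%N by rewrite subnK.
have sumy : (\sum_(l < n) y l = m)%N.
  apply/eqP; rewrite -(eqn_add2r 1) -{1}(sum1 i) -big_split /=.
  by rewrite (eq_bigr _ (fun l _ => yE l)) big_split /= sumx sum1.
have y_le l : (y l < m.+1)%N by rewrite ltnS -sumy (bigD1 l) //= leq_addr.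
have in_state : (\sum_(l < n) [ffun k => inord (y k) : 'I_m.+1] l)%N == m.
  apply/eqP; apply: etrans sumy; apply: eq_bigr => l _.
  by rewrite ffunE (@inordK m).
rewrite /occ /zrp_move val_insubd in_state ffunE inordK; first exact: yE.
exact: y_le.
Qed.

Definition zrp_generator (r : 'I_n -> nat -> R) (G : 'M[R]_n)
    (f : zrp_state -> R) (x : zrp_state) : R :=
  \sum_(i < n) \sum_(j < n)
    r i (occ x i) * G i j * (f (zrp_move x i j) - f x).

Definition zrp_weight (r : 'I_n -> nat -> R) (x : zrp_state) : R :=
  \prod_(i < n) \prod_(1 <= k < (occ x i).+1) (r i k)^-1.

Definition zrp_measure (r : 'I_n -> nat -> R) (x : zrp_state) : R :=
  zrp_weight r x / \sum_(y : zrp_state) zrp_weight r y.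

End ZeroRange.

(* Main.v *)
Require Import Defs.
From HB Require Import structures.
From mathcomp Require Import all_boot all_order all_algebra.
From mathcomp Require Import reals exp.
From mathcomp Require Import ring lra zify.

(* Entropy is decomposed along one site at a time.  Conditioning on the occupation
   of site i splits the entropy into the entropy of the process on the remaining
   sites, treated by induction on the number of sites, and the entropy of a
   birth-death chain, the law of x_i.  Averaging over i, the constants add up to
   2 (Delta / delta) L, where L is a log-Sobolev constant for all the
   birth-death chains.

   Comparing the Dirichlet form of the birth-death chain with that of the process
   requires coupling the measures with N and N+1 particles so that they differ by
   a single particle whose conditional law on the sites is at most
   (Delta / delta) / n.  The stationary law of a second class particle does this:
   it leaves each site at rate at least delta and jumps to a given site at rate at
   most Delta / n, so a maximum principle applies.  The coupling also shows that
   the birth rates Z_{N-1} / Z_N increase with N.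

   For a birth-death chain reversible for nu, whose drift d - b has increments
   at least 1, the entropy of h^2 is at most E[g^2 ln(1/nu)] + 3 Var h with g the
   centred h; the first term is controlled by a Lyapunov function that grows away
   from the mode of nu, the second one by the Poincare inequality. *)

Set Implicit Arguments.
Unset Strict Implicit.
Unset Printing Implicit Defensive.

Import Order.TTheory GRing.Theory Num.Theory.
Local Open Scope ring_scope.

(** * Birth-death chains *)

Section OneDimensional.
Variable R : realType.
Implicit Types (nu d b g h : nat -> R).

Lemma ln_le_sub1 (x : R) : 0 < x -> ln x <= x - 1.
Proof.
move=> x0; have -> : ln x = ln (1 + (x - 1)) by congr ln; ring.
by apply: le_ln1Dx; lra.
Qed.

(** As (15/14)^10 <= 2, ln 2 is at least ten times ln (15/14), which is at least 1/15. *)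
Lemma ln2_ge : 2 / 3 <= ln (2 : R).
Proof.
have h1 : ln (14 / 15 : R) <= - 15^-1.
  by have := @ln_le_sub1 (14 / 15); lra.
have h2 : ln ((15 / 14) ^+ 10 : R) <= ln 2.
  by rewrite ler_ln ?posrE; lra.
rewrite lnXn in h2; last by lra.
have h3 : ln (15 / 14 : R) = - ln (14 / 15).
  by rewrite -lnV ?posrE ?invf_div //; lra.
rewrite h3 -[_ *+ 10]mulr_natr in h2; lra.
Qed.

(** The last right-hand side is minus the generator applied to [V], divided by [V], when [V] grows
    by the factors [1 + t] and [1 + t'] across the two edges at a state with rates [d] and [b]. With
    [q = t / (1 + t)], the slope 4/33 is 2/3 * 9/11 * 2/9; the loss 17/33 adds 4/33 from the
    constant 2/9, 2/33 from [q / 3] and 1/3 from [b * t']. *)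
Lemma lyapunov_pointwise (t t' d b i U L : R) :
  0 <= t -> t <= 2 / 9 -> 0 <= d - b -> i - 1 <= d - b -> 0 < L ->
  b * t' <= b * t + 1 / 3 -> b * t <= i / 3 -> U <= i * L ->
  2 / 9 * (U / L) - 2 / 9 <= (d - b) * t ->
  4 / 33 * (U / L) - 17 / 33 <= d * (t / (1 + t)) - b * t'.
Proof.
move=> t0 t1 th0 thi L0 ht' ht hU key.
have p1 : 0 < 1 + t by lra.
set q := t / (1 + t).
have q0 : 9 / 11 * t <= q.
  by rewrite /q ler_pdivlMr //; nra.
have q1 : q <= 2 / 11 by rewrite /q ler_pdivrMr //; lra.
have qE : q * (1 + t) = t by rewrite /q divfK // gt_eqF.
have e1 : d * q - b * t = q * (d - b - b * t).
  have -> : d * q - b * t = d * q - b * (q * (1 + t)) by rewrite qE.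
  ring.
(* [b * t] is at most a third of [i], hence of [d - b + 1]. *)
have e2 : q * (2 / 3 * (d - b) - 1 / 3) <= q * (d - b - b * t).
  by apply: ler_wpM2l; lra.
have e3 : 9 / 11 * t * (d - b) <= q * (d - b) by apply: ler_wpM2r.
nra.
Qed.

(** The Lyapunov bound on a single edge, across which [V] is multiplied by [1 + t]: the two sides
    differ by a square. *)
Lemma sqr_diff_ge (u v t : R) : 0 <= t ->
  t / (1 + t) * u ^+ 2 - t * v ^+ 2 <= (u - v) ^+ 2.
Proof.
move=> t0; have p1 : 0 < 1 + t by lra.
rewrite -subr_ge0.
have -> : (u - v) ^+ 2 - (t / (1 + t) * u ^+ 2 - t * v ^+ 2)
  = (u - (1 + t) * v) ^+ 2 / (1 + t).
  by field; lra.
by rewrite divr_ge0 ?sqr_ge0 // ltW.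
Qed.

(* With V i = prod_(j <= i) (1 + t j) and L the generator of the chain, the
   Dirichlet form of g dominates the integral of g^2 (- L V / V).  The slope t may
   increase by 1 / (3 b) only, so that the variation of b * t costs at most 1/3; its
   product with the drift still dominates ln (nu 0 / nu i) / L, up to a constant. *)
Lemma lyapunov_right (N : nat) nu d b g (L : R) :
  (forall i, (i <= N)%N -> 0 < nu i) ->
  (forall i, (i < N)%N -> nu i.+1 * d i.+1 = nu i * b i) ->
  (forall i, (i < N)%N -> 0 < b i) -> b N = 0 ->
  (forall i, (i < N)%N -> d i <= d i.+1) ->
  (forall i, (i < N)%N -> b i.+1 <= b i) ->
  (forall i, (i < N)%N -> i%:R <= d i.+1 - b i.+1) ->
  2 / 3 <= L -> (forall i, (i < N)%N -> ln (d i.+1 / b i) <= L) ->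
  (forall i, (i <= N)%N -> nu i <= nu 0%N) ->
  \sum_(i < N) nu i.+1 * g i.+1 ^+ 2
      * (4 / 33 * (ln (nu 0%N / nu i.+1) / L) - 17 / 33)
    - nu 0%N * g 0%N ^+ 2 / 3
  <= \sum_(i < N) nu i * b i * (g i.+1 - g i) ^+ 2.
Proof.
move=> nu0 bal b0 bN dm bm th L23 hL nmax.
pose T (i : nat) := \sum_(j < i) (b j)^-1.
(* The cap 2/9 ensures that [t / (1 + t)] is at least [9 / 11 * t]. *)
pose t (i : nat) := Num.min (2 / 9) (T i / 3).
have L0 : 0 < L by lra.
have T0 i : (i <= N)%N -> 0 <= T i.
  move=> iN; apply: sumr_ge0 => j _; rewrite invr_ge0 ltW // b0 //.
  exact: leq_trans iN.
have t0 i : (i <= N)%N -> 0 <= t i.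
  move=> iN; rewrite /t le_min; have := T0 i iN; lra.
have t29 i : t i <= 2 / 9 by rewrite /t ge_min lexx.
have bmon i j : (i <= j)%N -> (j <= N)%N -> b j <= b i.
  move=> ij jN; elim: j ij jN => [|j IH]; first by rewrite leqn0 => /eqP ->.
  rewrite leq_eqVlt => /orP[/eqP -> //|ij jN].
  apply: le_trans (bm j jN) _; apply: IH => //; exact: ltnW.
have dmon i j : (i <= j)%N -> (j <= N)%N -> d i <= d j.
  move=> ij jN; elim: j ij jN => [|j IH]; first by rewrite leqn0 => /eqP ->.
  rewrite leq_eqVlt => /orP[/eqP -> //|ij jN].
  apply: le_trans _ (dm j jN); apply: IH => //; exact: ltnW.
have TS i : T i.+1 = T i + (b i)^-1 by rewrite /T big_ord_recr.
(* As [b] decreases, each of the [i.+1] terms of [b i.+1 * T i.+1] is at most 1. *)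
have bT i : (i < N)%N -> b i.+1 * t i.+1 <= i.+1%:R / 3.
  move=> iN; have bi : 0 <= b i.+1.
    move: iN; rewrite leq_eqVlt => /orP[/eqP ->|iN]; first by rewrite bN.
    by rewrite ltW // b0.
  apply: (@le_trans _ _ (b i.+1 * (T i.+1 / 3))).
    by apply: ler_wpM2l => //; rewrite /t ge_min lexx orbT.
  rewrite mulrA ler_pM2r ?invr_gt0 ?ltr0n // /T mulr_sumr.
  rewrite -[leRHS]mulr1 mulr_natl -[X in _ *+ X]card_ord -sumr_const.
  apply: ler_sum => j _; have jN : (j < N)%N by exact: leq_trans iN.
  by rewrite ler_pdivrMr ?b0 // mul1r bmon // ltnW.
have bt' i : (i < N)%N -> b i.+1 * t i.+2 <= b i.+1 * t i.+1 + 1 / 3.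
  rewrite leq_eqVlt => /orP[/eqP ->|iN]; first by rewrite bN !mul0r; lra.
  have bi := b0 _ iN.
  have h : t i.+2 <= t i.+1 + (b i.+1)^-1 / 3.
    have : 0 <= (b i.+1)^-1 / 3 by rewrite divr_ge0 // invr_ge0 ltW.
    rewrite /t TS [(T _ + _) / 3]mulrDl ge_min; set c := (b _)^-1 / 3 => h0.
    by case: (leP (2 / 9) (T i.+1 / 3)) => _; apply/orP; [left; lra|right].
  apply: le_trans (ler_wpM2l (ltW bi) h) _.
  rewrite mulrDr; apply: lerD => //.
  by rewrite mulrA mulfV ?gt_eqF.
have dpos i : (i < N)%N -> 0 < d i.+1.
  move=> iN; have := mulr_gt0 (nu0 i (ltnW iN)) (b0 i iN).
  by rewrite -bal // pmulr_rgt0 // nu0.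
have step j : (j < N)%N -> ln (nu j / nu j.+1) = ln (d j.+1 / b j).
  move=> jN; congr ln; apply/eqP.
  have h1 := nu0 _ jN; have h2 := b0 _ jN.
  by rewrite (eqr_div _ _ (lt0r_neq0 h1) (lt0r_neq0 h2)) -bal // mulrC.
have Usum i : (i <= N)%N -> ln (nu 0%N / nu i) = \sum_(j < i) ln (d j.+1 / b j).
  elim: i => [|i IH] iN.
    by rewrite big_ord0 divff ?ln1 // gt_eqF // nu0.
  rewrite big_ord_recr /= -IH; last exact: ltnW.
  rewrite -step // -lnM ?posrE ?divr_gt0 ?nu0 //; try exact: ltnW.
  by congr ln; rewrite mulrA divfK // gt_eqF // nu0 // ltnW.
have UL i : (i <= N)%N -> ln (nu 0%N / nu i) <= i%:R * L.
  move=> iN; rewrite Usum // mulr_natl -[X in _ *+ X]card_ord -sumr_const.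
  by apply: ler_sum => j _; apply: hL; exact: leq_trans iN.
(* Each [ln (d j.+1 / b j)] is at most [(d j.+1 - b j) / b j], and by monotonicity of both rates the
   numerator is at most the drift at [i.+1]. *)
have UT i : (i < N)%N -> ln (nu 0%N / nu i.+1) <= (d i.+1 - b i.+1) * T i.+1.
  move=> iN; rewrite Usum // /T mulr_sumr; apply: ler_sum => j _.
  have jN : (j < N)%N by exact: leq_trans iN.
  have bj := b0 _ jN.
  apply: le_trans (ln_le_sub1 _) _; first by rewrite divr_gt0 // dpos.
  rewrite -[X in _ - X](divff (lt0r_neq0 bj)) -mulrBl ler_pM2r ?invr_gt0 //.
  apply: lerB; [exact: dmon | exact: bmon (ltnW (ltn_ord j)) _].
have U0 i : (i < N)%N -> 0 <= ln (nu 0%N / nu i.+1).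
  by move=> iN; apply: ln_ge0; rewrite ler_pdivlMr ?nu0 // mul1r nmax.
have coef i : (i < N)%N ->
   4 / 33 * (ln (nu 0%N / nu i.+1) / L) - 17 / 33
   <= d i.+1 * (t i.+1 / (1 + t i.+1)) - b i.+1 * t i.+2.
  move=> iN; have thi := th i iN.
  have th0 : 0 <= d i.+1 - b i.+1 by apply: le_trans thi; exact: ler0n.
  apply: (@lyapunov_pointwise _ _ _ _ i.+1%:R) => //.
  - exact: t0.
  - by rewrite -natr1 addrK.
  - exact: bt'.
  - exact: bT.
  - exact: UL.
  have hU := U0 i iN; have hUT := UT i iN; have hUL := UL _ iN.
  set U := ln _ in hU hUT hUL *.
  have UL1 : U / L <= i.+1%:R by rewrite ler_pdivrMr.
  have UL2 : U / L <= 3 / 2 * U.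
    rewrite ler_pdivrMr // mulrAC; nra.
  rewrite -natr1 in UL1.
  (* At the cap, the drift is at least [i] while [U / L] is at most [i.+1]. Below it, the drift
     times [T i.+1 / 3] is at least [U / 3], hence at least [2 / 9 * (U / L)] because [L] is at
     least 2/3. *)
  rewrite /t minEle; case: ifP => _.
    have := ler_wpM2r (_ : 0 <= 2 / 9 :> R) thi; lra.
  lra.
have edge i : (i < N)%N -> nu i.+1 * g i.+1 ^+ 2 * (d i.+1 * (t i.+1 / (1 + t i.+1)))
    - nu i * g i ^+ 2 * (b i * t i.+1) <= nu i * b i * (g i.+1 - g i) ^+ 2.
  move=> iN.
  have -> : nu i.+1 * g i.+1 ^+ 2 * (d i.+1 * (t i.+1 / (1 + t i.+1)))
     = nu i.+1 * d i.+1 * (t i.+1 / (1 + t i.+1) * g i.+1 ^+ 2) by ring.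
  rewrite bal //.
  have -> : nu i * b i * (t i.+1 / (1 + t i.+1) * g i.+1 ^+ 2)
     - nu i * g i ^+ 2 * (b i * t i.+1)
     = nu i * b i * (t i.+1 / (1 + t i.+1) * g i.+1 ^+ 2 - t i.+1 * g i ^+ 2) by ring.
  apply: ler_wpM2l; last by apply: sqr_diff_ge; exact: t0.
  by rewrite mulr_ge0 // ltW ?nu0 ?b0 // ltnW.
apply: le_trans (ler_sum _ (fun (i : 'I_N) _ => edge i (ltn_ord i))).
rewrite sumrB.
have -> : \sum_(i < N) nu i * g i ^+ 2 * (b i * t i.+1) =
   \sum_(i < N) nu i.+1 * g i.+1 ^+ 2 * (b i.+1 * t i.+2)
   + nu 0%N * g 0%N ^+ 2 * (b 0%N * t 1%N).
  (* The same sum with one more term is split at its last index, where [b N = 0], and at its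
     first. *)
  have : \sum_(i < N.+1) nu i * g i ^+ 2 * (b i * t i.+1) =
         \sum_(i < N.+1) nu i * g i ^+ 2 * (b i * t i.+1) by [].
  rewrite {1}big_ord_recr big_ord_recl /= bN mul0r mulr0 addr0 => ->.
  by rewrite addrC.
rewrite opprD addrA -sumrB; apply: lerD.
  apply: ler_sum => i _; rewrite -mulrBr.
  apply: ler_wpM2l; last exact: coef.
  by rewrite mulr_ge0 ?sqr_ge0 // ltW // nu0.
rewrite lerN2; apply: ler_wpM2l.
  by rewrite mulr_ge0 ?sqr_ge0 // ltW // nu0.
case: (posnP N) => [N0|Np].
  by rewrite -{1}N0 bN mul0r invr_ge0.
have bp := b0 _ Np.
apply: (@le_trans _ _ (b 0%N * (T 1%N / 3))).
  by apply: ler_wpM2l; [exact: ltW | rewrite /t ge_min lexx orbT].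
by rewrite /T big_ord_recl big_ord0 addr0 mulrA mulfV ?gt_eqF ?mul1r.
Qed.

(** [lyapunov_right] is applied on both sides of the mode [a]: to the chain shifted by [a], and to
    the reflected chain, where births and deaths exchange roles. The mode is charged 1/3 by each
    side and every other state 17/33, so 2/3 covers all of them. *)
Lemma weighted_energy (a n : nat) nu d b g (L : R) :
  (forall i, (i <= a + n)%N -> 0 < nu i) ->
  (forall i, (i < a + n)%N -> nu i.+1 * d i.+1 = nu i * b i) ->
  (forall i, (i < a + n)%N -> 0 < b i) -> b (a + n)%N = 0 ->
  (forall i, (i < a + n)%N -> 0 < d i.+1) -> d 0%N = 0 ->
  (forall i, (i < a + n)%N -> d i <= d i.+1) ->
  (forall i, (i < a + n)%N -> b i.+1 <= b i) ->
  (forall i, (i < a + n)%N -> 1 <= (d i.+1 - b i.+1) - (d i - b i)) ->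
  2 / 3 <= L -> (forall i, (i < a + n)%N -> ln (d i.+1 / b i) <= L) ->
  (forall i, (i < a + n)%N -> ln (b i / d i.+1) <= L) ->
  (forall i, (i <= a + n)%N -> nu i <= nu a) ->
  \sum_(k < (a + n).+1) nu k * g k ^+ 2 * (4 / 33 * (ln (nu a / nu k) / L))
  <= \sum_(k < a + n) nu k * b k * (g k.+1 - g k) ^+ 2
     + 2 / 3 * \sum_(k < (a + n).+1) nu k * g k ^+ 2.
Proof.
move=> nu0 bal b0 bN d0 dN dm bm th L23 hL hL' nmax.
have L0 : 0 < L by lra.
have thD i j : (i + j <= a + n)%N -> d i - b i + j%:R <= d (i + j)%N - b (i + j)%N.
  elim: j => [|j IH] ij; first by rewrite addn0 addr0.
  rewrite addnS in ij *; have := IH (ltnW ij); have := th _ ij; rewrite -natr1; lra.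
have na : 0 < nu a by rewrite nu0 // leq_addr.
have right : \sum_(i < n) nu (a + i.+1)%N * g (a + i.+1)%N ^+ 2
      * (4 / 33 * (ln (nu a / nu (a + i.+1)%N) / L) - 17 / 33)
    - nu a * g a ^+ 2 / 3
  <= \sum_(i < n) nu (a + i)%N * b (a + i)%N * (g (a + i)%N.+1 - g (a + i)%N) ^+ 2.
  have := @lyapunov_right n (fun i => nu (a + i)%N) (fun i => d (a + i)%N)
     (fun i => b (a + i)%N) (fun i => g (a + i)%N) L.
  rewrite addn0 => H.
  under [X in _ <= X]eq_bigr do rewrite -addnS.
  apply: H => //.
  - by move=> i ?; rewrite nu0 // leq_add2l.
  - by move=> i ?; rewrite addnS bal // ltn_add2l.
  - by move=> i ?; rewrite b0 // ltn_add2l.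
  - by move=> i ?; rewrite addnS dm // ltn_add2l.
  - by move=> i ?; rewrite addnS bm // ltn_add2l.
  (* Since [a] is the mode, balance gives [b a <= d a.+1]: the drift is nonnegative at [a.+1], and
     then gains at least 1 per step. *)
  - move=> i ni; have an : (a < a + n)%N by rewrite -[ltnLHS]addn0 ltn_add2l; case: (n) ni.
    have h1 : 0 <= d a.+1 - b a.+1.
      have h2 : b a <= d a.+1.
        rewrite -(ler_pM2l na) -bal // ler_pM2r ?d0 //; exact: nmax.
      have := bm _ an; lra.
    have := thD a.+1 i; rewrite addSnnS leq_add2l => /(_ ni); lra.
  - by move=> i ?; rewrite addnS hL // ltn_add2l.
  - by move=> i ?; rewrite nmax // leq_add2l.
have left : \sum_(i < a) nu i * g i ^+ 2
      * (4 / 33 * (ln (nu a / nu i) / L) - 17 / 33)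
    - nu a * g a ^+ 2 / 3
  <= \sum_(i < a) nu i * b i * (g i.+1 - g i) ^+ 2.
  have := @lyapunov_right a (fun i => nu (a - i)%N) (fun i => b (a - i)%N)
     (fun i => d (a - i)%N) (fun i => g (a - i)%N) L.
  have lt i : (i <= a)%N -> (a - i <= a + n)%N.
    by move=> _; apply: leq_trans (leq_subr _ _) (leq_addr _ _).
  have sS i : (i < a)%N -> (a - i = (a - i.+1).+1)%N by move=> ia; rewrite subnSK.
  have lt' i : (i < a)%N -> (a - i.+1 < a + n)%N by move=> ia; rewrite -sS // lt // ltnW.
  rewrite subn0 subnn => H.
  rewrite [X in X - _](reindex_inj rev_ord_inj) [X in _ <= X](reindex_inj rev_ord_inj) /=.
  under [X in _ <= X]eq_bigr => i _.
    rewrite -bal ?lt' // -sS // -sqrrN opprB; over.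
  apply: H => //.
  - by move=> i ia; rewrite nu0 // lt.
  - by move=> i ia; rewrite (sS i) // bal // lt'.
  - by move=> i ia; rewrite (sS i) // d0 // lt'.
  - by move=> i ia; rewrite (sS i) // bm // lt'.
  - by move=> i ia; rewrite (sS i) // dm // lt'.
  - move=> i ia; have a0 : (0 < a)%N by exact: leq_ltn_trans ia.
    have h1 : d a.-1 - b a.-1 <= 0.
      have aa : (a.-1 < a + n)%N by rewrite prednK // leq_addr.
      have h2 : d a <= b a.-1.
        have := bal a.-1 aa; rewrite prednK // => e.
        have p : 0 < nu a.-1 by rewrite nu0 // ltnW.
        rewrite -(ler_pM2l p) -e ler_pM2r; last by have := d0 _ aa; rewrite prednK.
        by apply: nmax; exact: ltnW.
      have := dm _ aa; rewrite prednK //; lra.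
    have := thD (a - i.+1)%N i; have -> : (a - i.+1 + i = a.-1)%N.
      by lia.
    have -> : (a.-1 <= a + n)%N by apply: leq_trans (leq_pred _) (leq_addr _ _).
    move=> /(_ isT); lra.
  - by move=> i ia; rewrite (sS i) // hL' // lt'.
  - by move=> i ia; rewrite nmax // lt.
rewrite -[(a + n).+1]addnS !big_split_ord /= !big_ord_recl /= !addn0 /bump /=.
under [X in _ + (_ + X) <= _]eq_bigr do rewrite add1n.
under [X in _ <= _ + _ * (_ + (_ + X))]eq_bigr do rewrite add1n.

rewrite divff ?gt_eqF // ln1 mul0r mulr0 mulr0 add0r.
have e (m : nat) (F G : nat -> R) :
   \sum_(i < m) F i * (G i - 17 / 33) = \sum_(i < m) F i * G i - 17 / 33 * \sum_(i < m) F i.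
  by rewrite mulr_sumr -sumrB; apply: eq_bigr => i _; ring.
rewrite (e n (fun i => nu (a + i.+1)%N * g (a + i.+1)%N ^+ 2)
  (fun i => 4 / 33 * (ln (nu a / nu (a + i.+1)%N) / L))) in right.
rewrite (e a (fun i => nu i * g i ^+ 2)
  (fun i => 4 / 33 * (ln (nu a / nu i) / L))) in left.
have p1 : 0 <= \sum_(i < n) nu (a + i.+1)%N * g (a + i.+1)%N ^+ 2.
  apply: sumr_ge0 => i _; rewrite mulr_ge0 ?sqr_ge0 // ltW // nu0 //.
  by rewrite leq_add2l.
have p2 : 0 <= \sum_(i < a) nu i * g i ^+ 2.
  apply: sumr_ge0 => i _; rewrite mulr_ge0 ?sqr_ge0 // ltW // nu0 //.
  by apply: leq_trans (ltnW (ltn_ord i)) (leq_addr _ _).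
have p3 : 0 <= nu a * g a ^+ 2 by rewrite mulr_ge0 ?sqr_ge0 // ltW.
lra.
Qed.

(** * Poincare and log-Sobolev inequalities for birth-death chains *)

Lemma covariance_double (T : finType) (nu F G : T -> R) :
  \sum_k nu k = 1 ->
  \sum_k \sum_l nu k * nu l * ((F k - F l) * (G k - G l))
  = 2 * (\sum_k nu k * (F k * G k) - (\sum_k nu k * F k) * (\sum_k nu k * G k)).
Proof.
move=> nu1.
have e k : \sum_l nu k * nu l * ((F k - F l) * (G k - G l))
   = nu k * (F k * G k) - nu k * F k * (\sum_l nu l * G l)
     - nu k * G k * (\sum_l nu l * F l) + nu k * (\sum_l nu l * (F l * G l)).
  rewrite -[X in X - _ - _ + _]mulr1 -nu1 !mulr_sumr -!sumrB -big_split /=.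
  by apply: eq_bigr => l _; ring.
under eq_bigr do rewrite e.
by rewrite big_split !sumrB /= -!mulr_suml nu1; ring.
Qed.

(** Let [theta = d - b] be the drift and [S] the running sum of squared increments of [h]. As
    [theta] has increments at least 1, Cauchy-Schwarz gives [(h k - h l) ^+ 2 <= (theta k - theta l)
    * (S k - S l)], so the variance of [h] is at most the covariance of [theta] and [S]. Summation
    by parts identifies the latter with the Dirichlet form. *)
Lemma poincare_1d (N : nat) nu d b h :
  (forall i, (i <= N)%N -> 0 < nu i) ->
  (forall i, (i < N)%N -> nu i.+1 * d i.+1 = nu i * b i) ->
  b N = 0 -> d 0%N = 0 ->
  (forall i, (i < N)%N -> 1 <= (d i.+1 - b i.+1) - (d i - b i)) ->
  \sum_(k < N.+1) nu k = 1 ->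
  \sum_(k < N.+1) nu k * h k ^+ 2 - (\sum_(k < N.+1) nu k * h k) ^+ 2
  <= \sum_(k < N) nu k * b k * (h k.+1 - h k) ^+ 2.
Proof.
move=> nu0 bal bN d0 th nu1.
pose theta i := d i - b i; pose D i := (h i.+1 - h i) ^+ 2.
pose S (k : nat) := \sum_(j < k) D j.
have th' i : (i < N)%N -> 1 <= theta i.+1 - theta i by exact: th.
have thm l j : (l + j <= N)%N -> theta l + j%:R <= theta (l + j)%N.
  elim: j => [|j IH] ij; first by rewrite addn0 addr0.
  rewrite addnS in ij *; have := IH (ltnW ij); have := th' _ ij; rewrite -natr1; lra.
have Sm l j : S l <= S (l + j)%N.
  by rewrite /S big_split_ord /= lerDl sumr_ge0 // => i _; exact: sqr_ge0.
have key l j : (l + j <= N)%N ->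
  (h (l + j)%N - h l) ^+ 2 <= (theta (l + j)%N - theta l) * (S (l + j)%N - S l).
  elim: j => [|j IH] ij; first by rewrite addn0 !subrr expr2 mul0r.
  rewrite addnS in ij *; have /IH := ltnW ij.
  have := thm _ _ (ltnW ij); have := th' _ ij; have := Sm l j; have j0 := ler0n R j.
  have -> : S (l + j).+1 = S (l + j)%N + D (l + j)%N by rewrite /S big_ord_recr.
  rewrite /D.
  set A := h (l + j)%N; set B := h (l + j).+1.
  set t1 := theta (l + j)%N; set t2 := theta (l + j).+1; set s := S (l + j)%N.
  move=> hs ht tj IH'.
  have -> : B - h l = (A - h l) + (B - A) by ring.
  move: (A - h l) (B - A) IH' => x y IH'.
  have [T0 U0] : 0 <= t1 - theta l /\ 0 <= s - S l by split; lra.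
  have -> : s + y ^+ 2 - S l = (s - S l) + y ^+ 2 by ring.
  have -> : t2 - theta l = (t1 - theta l) + (t2 - t1) by ring.
  move: (t1 - theta l) (s - S l) (t2 - t1) T0 U0 ht IH' => p q e p0 q0 e1 xpq.
  (* Arithmetic-geometric mean, from [x ^+ 2 <= p * q]; when [p] vanishes, so does [x]. *)
  have h2 : 2 * x * y <= p * y ^+ 2 + q.
    case: (eqVneq p 0) => [pz|pn].
      have x0 : x = 0.
        by apply/eqP; rewrite -sqrf_eq0 eq_le sqr_ge0 andbT; rewrite pz mul0r in xpq.
      by rewrite x0 pz; lra.
    have pp : 0 < p by rewrite lt0r pn.
    rewrite -(ler_pM2l pp).
    have : 0 <= (p * y - x) ^+ 2 by exact: sqr_ge0.
    nra.
  have := sqr_ge0 y; nra.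
have key' k l : (k <= N)%N -> (l <= N)%N ->
  (h k - h l) ^+ 2 <= (theta k - theta l) * (S k - S l).
  move=> kN lN; case: (leqP l k) => kl.
    by have := @key l (k - l)%N; rewrite subnKC // => /(_ kN).
  have := @key k (l - k)%N; rewrite subnKC ?(ltnW kl) // => /(_ lN).
  by rewrite -sqrrN opprB; congr (_ <= _); ring.
have cov1 := @covariance_double _ (fun k : 'I_N.+1 => nu k) (fun k => h k) (fun k => h k) nu1.
have cov2 := @covariance_double _ (fun k : 'I_N.+1 => nu k) (fun k => theta k) (fun k => S k) nu1.
(* By balance, the death term at each state cancels the birth term at the preceding one. *)
have mtheta n : (n <= N)%N -> \sum_(k < n.+1) nu k * theta k = - (nu n * b n).
  elim: n => [|n IH] nN; first by rewrite big_ord_recl big_ord0 /theta d0; ring.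
  by rewrite big_ord_recr /= IH ?(ltnW nN) // -bal // /theta; ring.
have tot : \sum_(k < N.+1) nu k * theta k = 0 by rewrite mtheta // bN; ring.
have thS : \sum_(k < N.+1) nu k * (theta k * S k) = \sum_(j < N) nu j * b j * D j.
  have SE (k : 'I_N.+1) : S k = \sum_(j < N) (if (j < k)%N then D j else 0).
    by rewrite -big_mkcond /= /S (big_ord_widen N D) // -ltnS.
  under eq_bigr => k _ do rewrite SE mulrA mulr_sumr.
  rewrite exchange_big /=; apply: eq_bigr => j _.
  under eq_bigr => k _.
    rewrite (_ : nu k * theta k * _ =
      (nu k * theta k - (if (k <= j)%N then nu k * theta k else 0)) * D j).
      over.
    by case: (leqP k j) => _; ring.
  have := @big_ord_widen _ 0 +%R j.+1 N.+1 (fun k => nu k * theta k).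
  rewrite ltnS => /(_ (ltnW (ltn_ord j))) => W.
  rewrite -mulr_suml sumrB tot -big_mkcond /= -W mtheta ?(ltnW (ltn_ord j)) //; ring.
have : \sum_(k < N.+1) \sum_(l < N.+1) nu k * nu l * ((h k - h l) * (h k - h l))
   <= \sum_(k < N.+1) \sum_(l < N.+1) nu k * nu l * ((theta k - theta l) * (S k - S l)).
  apply: ler_sum => k _; apply: ler_sum => l _.
  rewrite -expr2 ler_pM2l ?mulr_gt0 ?nu0 ?key' // -ltnS //.
rewrite cov1 cov2 thS tot mul0r subr0 ler_pM2l // expr2.
Qed.

(* Used with v = nu k and c the mean of c + g: the terms linear in g then integrate
   to 0, so that Rothaus' lemma is not needed. *)
Lemma entropy_pointwise (c g v : R) :
  0 <= c -> c <= 1 -> 0 <= c + g -> 0 < v -> v <= 1 -> v * (c + g) ^+ 2 <= 1 ->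
  (c + g) ^+ 2 * ln ((c + g) ^+ 2)
  <= g ^+ 2 * ln (v^-1) + 2 * (c ^+ 2 + 2 * c * g) * (g - (1 - c)).
Proof.
move=> c0 c1 h0 v0 v1 hv.
have lv : 0 <= ln v^-1 by apply: ln_ge0; rewrite invf_ge1.
have g2 : 0 <= g ^+ 2 * ln v^-1 by rewrite mulr_ge0 // sqr_ge0.
case: (eqVneq (c + g) 0) => [z|nz].
  have -> : g = - c by lra.
  by move: g2; have -> : g = - c by [lra]; rewrite subrr expr2; nra.
have hp : 0 < c + g by rewrite lt0r nz.
have hln : ln ((c + g) ^+ 2) <= 2 * (g - (1 - c)).
  rewrite lnXn // -mulr_natl; have := ln_le_sub1 hp; lra.
have hv' : ln ((c + g) ^+ 2) <= ln v^-1.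
  by rewrite ler_ln ?posrE ?invr_gt0 ?exprn_gt0 // -[_^-1]mul1r ler_pdivlMr // mulrC.
(* For [g >= 0] the factor [(c + g) ^+ 2] is split: [g ^+ 2] is paired with the bound [ln v^-1] of
   the logarithm, the rest with its linear bound. For [g < 0] the linear bound suffices, since its
   product with [g ^+ 2] is nonpositive. *)
case: (leP 0 g) => g0.
  have p : 0 <= c ^+ 2 + 2 * c * g by rewrite addr_ge0 ?sqr_ge0 ?mulr_ge0.
  have e : g ^+ 2 + (c ^+ 2 + 2 * c * g) = (c + g) ^+ 2 by ring.
  rewrite -[X in X * ln _]e mulrDl.
  apply: lerD; first by apply: ler_wpM2l => //; exact: sqr_ge0.
  by have := ler_wpM2l p hln; lra.
apply: le_trans (ler_wpM2l (sqr_ge0 _) hln) _.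
have := sqr_ge0 g; nra.
Qed.

(** [entropy_pointwise] is integrated with [ln (1 / nu k)] split at the mode [a]. In units of [ln M]
    times the Dirichlet form, [ln (nu a / nu k)] costs 33/4 * 5/3 = 55/4 by [weighted_energy] and
    Poincare; [ln (1 / nu a)] costs 1, because [nu a] is at least [1 / N.+1]; the variance term
    costs 9/2. The sum is 77/4, below 20. *)
Lemma lsi_1d_normalized (N : nat) nu d b h (M : R) :
  (forall i, (i <= N)%N -> 0 < nu i) ->
  (forall i, (i < N)%N -> nu i.+1 * d i.+1 = nu i * b i) ->
  (forall i, (i < N)%N -> 0 < b i) -> b N = 0 ->
  (forall i, (i < N)%N -> 0 < d i.+1) -> d 0%N = 0 ->
  (forall i, (i < N)%N -> d i <= d i.+1) ->
  (forall i, (i < N)%N -> b i.+1 <= b i) ->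
  (forall i, (i < N)%N -> 1 <= (d i.+1 - b i.+1) - (d i - b i)) ->
  2 <= M -> N.+1%:R <= M ->
  (forall i, (i < N)%N -> d i.+1 <= M * b i) ->
  (forall i, (i < N)%N -> b i <= M * d i.+1) ->
  (forall i, 0 <= h i) ->
  \sum_(k < N.+1) nu k = 1 -> \sum_(k < N.+1) nu k * h k ^+ 2 = 1 ->
  \sum_(k < N.+1) nu k * (h k ^+ 2 * ln (h k ^+ 2))
  <= 20 * ln M * \sum_(k < N) nu k * b k * (h k.+1 - h k) ^+ 2.
Proof.
move=> nu0 bal b0 bN d0 dN dm bm th M2 MN hM hM' h0 nu1 h1.
set E := \sum_(k < N) _.
have M0 : 0 < M by lra.
have L23 : 2 / 3 <= ln M.
  apply: le_trans ln2_ge _; rewrite ler_ln ?posrE //; lra.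
set L := ln M in L23 *.
have E0 : 0 <= E.
  apply: sumr_ge0 => k _; rewrite mulr_ge0 ?sqr_ge0 // mulr_ge0 // ltW ?nu0 ?b0 //.
  exact: ltnW.
have nu_le k : (k <= N)%N -> nu k <= 1.
  move=> kN; rewrite -nu1; have kN' : (k < N.+1)%N by [].
  rewrite (bigD1 (Ordinal kN')) //= lerDl sumr_ge0 // => i _.
  by rewrite ltW // nu0 // -ltnS.
have poin := poincare_1d h nu0 bal bN dN th nu1; rewrite h1 -/E in poin.
pose c := \sum_(k < N.+1) nu k * h k; rewrite -/c in poin.
have c0 : 0 <= c by apply: sumr_ge0 => k _; rewrite mulr_ge0 // ltW // nu0 // -ltnS.
pose g k := h k - c.
have gE : \sum_(k < N.+1) nu k * g k = 0.
  under eq_bigr do rewrite mulrBr; rewrite sumrB -mulr_suml nu1 -/c; ring.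
have g2E : \sum_(k < N.+1) nu k * g k ^+ 2 = 1 - c ^+ 2.
  have e k : nu k * g k ^+ 2 = nu k * h k ^+ 2 - nu k * h k * (2 * c) + nu k * c ^+ 2.
    by rewrite /g; ring.
  under eq_bigr do rewrite e.
  by rewrite big_split sumrB /= -!mulr_suml h1 nu1 -/c; ring.
have g20 : 0 <= \sum_(k < N.+1) nu k * g k ^+ 2.
  by apply: sumr_ge0 => k _; rewrite mulr_ge0 ?sqr_ge0 // ltW // nu0 // -ltnS.
have c1 : c <= 1.
  by rewrite -(@ler_pXn2r _ 2) ?nnegrE // expr1n -subr_ge0 -g2E.
pose a0 := [arg max_(i > (ord0 : 'I_N.+1)) nu i]%O.
have amax (k : 'I_N.+1) : nu k <= nu a0.
  by rewrite /a0; case: arg_maxP => // i _ H; exact: H.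
have [a [n [aE eN]]] : exists a n, nat_of_ord a0 = a /\ N = (a + n)%N.
  exists a0, (N - a0)%N; split=> //; rewrite subnKC // -ltnS; exact: ltn_ord.
have nmax i : (i <= N)%N -> nu i <= nu a.
  by move=> iN; have := amax (@Ordinal N.+1 i iN); rewrite aE.
have aN : (a <= N)%N by rewrite eN leq_addr.
have na : 0 < nu a by rewrite nu0.
have nua : ln (nu a)^-1 <= L.
  rewrite ler_ln ?posrE ?invr_gt0 //; apply: le_trans MN.
  rewrite -[_^-1]mul1r ler_pdivrMr // -[leLHS]nu1 mulr_natl -[X in _ *+ X]card_ord -sumr_const.
  by apply: ler_sum => k _; apply: nmax; rewrite -ltnS.
have hL i : (i < N)%N -> ln (d i.+1 / b i) <= L.
  move=> iN; rewrite ler_ln ?posrE ?divr_gt0 ?d0 ?b0 //.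
  by rewrite ler_pdivrMr ?b0 // hM.
have hL' i : (i < N)%N -> ln (b i / d i.+1) <= L.
  move=> iN; rewrite ler_ln ?posrE ?divr_gt0 ?d0 ?b0 //.
  by rewrite ler_pdivrMr ?d0 // hM'.
have WE : \sum_(k < N.+1) nu k * g k ^+ 2 * (4 / 33 * (ln (nu a / nu k) / L))
    <= E + 2 / 3 * \sum_(k < N.+1) nu k * g k ^+ 2.
  move: (nu0) bal b0 bN d0 dm bm th hL hL' nmax; rewrite /E.
  have -> : \sum_(k < N) nu k * b k * (h k.+1 - h k) ^+ 2
     = \sum_(k < N) nu k * b k * (g k.+1 - g k) ^+ 2.
    apply: eq_bigr => k _; rewrite /g; ring.
  rewrite eN => *.
  by apply: (@weighted_energy a n nu d b g L).
have L0 : 0 < L by lra.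
have U : \sum_(k < N.+1) nu k * (g k ^+ 2 * ln (nu a / nu k)) <= 55 / 4 * L * E.
  have e (k : nat) : nu k * (g k ^+ 2 * ln (nu a / nu k))
     = 33 / 4 * L * (nu k * g k ^+ 2 * (4 / 33 * (ln (nu a / nu k) / L))).
    by field; rewrite gt_eqF.
  under eq_bigr do rewrite e.
  rewrite -mulr_sumr.
  have -> : 55 / 4 * L * E = 33 / 4 * L * (E + 2 / 3 * E) by field.
  apply: ler_wpM2l; first by lra.
  by apply: le_trans WE _; rewrite g2E; lra.
have pw k : (k <= N)%N -> h k ^+ 2 * ln (h k ^+ 2) <=
   g k ^+ 2 * (ln (nu a / nu k) + L) + (4 * c * g k ^+ 2
     + (2 * c ^+ 2 - 4 * c * (1 - c)) * g k - 2 * c ^+ 2 * (1 - c)).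
  move=> kN; have nk := nu0 k kN.
  have hk : h k = c + g k by rewrite /g; ring.
  have := @entropy_pointwise c (g k) (nu k); rewrite -hk => /(_ c0 c1 (h0 k) nk (nu_le k kN)) H.
  have hv : nu k * h k ^+ 2 <= 1.
    rewrite -h1; have kN' : (k < N.+1)%N by [].
    rewrite (bigD1 (Ordinal kN')) //= lerDl sumr_ge0 // => i _.
    by rewrite mulr_ge0 ?sqr_ge0 // ltW // nu0 // -ltnS.
  apply: le_trans (H hv) _.
  have lnE : ln (nu k)^-1 = ln (nu a / nu k) + ln (nu a)^-1.
    rewrite -lnM ?posrE ?divr_gt0 ?invr_gt0 //; congr ln.
    by field; rewrite !gt_eqF.
  have := ler_wpM2l (sqr_ge0 (g k)) nua; rewrite lnE; nra.
have : \sum_(k < N.+1) nu k * (h k ^+ 2 * ln (h k ^+ 2)) <=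
   \sum_(k < N.+1) (nu k * (g k ^+ 2 * ln (nu a / nu k)) + nu k * g k ^+ 2 * (L + 4 * c)
     + nu k * g k * (2 * c ^+ 2 - 4 * c * (1 - c))
     + nu k * (- 2 * c ^+ 2 * (1 - c))).
  apply: ler_sum => k _; have kN : (k <= N)%N by rewrite -ltnS.
  have := ler_wpM2l (ltW (nu0 k kN)) (pw k kN); lra.
rewrite !big_split /= -!mulr_suml gE g2E nu1 mul0r addr0 mul1r => H.
apply: le_trans H _; set X := \sum_(k < N.+1) _ in U *.
(* Up to the factor [1 - c], this is [(2 * c + 3) * (c - 1) <= 0]. *)
have h3 : (1 - c ^+ 2) * (4 * c) - 2 * c ^+ 2 * (1 - c) <= 3 * (1 - c ^+ 2) by nra.
have h4 : (1 - c ^+ 2) * L <= E * L by rewrite ler_pM2r.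
have h5 : 3 * (1 - c ^+ 2) <= 9 / 2 * (L * E) by nra.
lra.
Qed.

(** Both sides are homogeneous in [nu] and in [phi], which reduces to total mass 1 and to [h] the
    square root of [phi] divided by its mean. *)
Lemma lsi_1d (N : nat) nu d b (phi : nat -> R) (M : R) :
  (forall i, (i <= N)%N -> 0 < nu i) ->
  (forall i, (i < N)%N -> nu i.+1 * d i.+1 = nu i * b i) ->
  (forall i, (i < N)%N -> 0 < b i) -> b N = 0 ->
  (forall i, (i < N)%N -> 0 < d i.+1) -> d 0%N = 0 ->
  (forall i, (i < N)%N -> d i <= d i.+1) ->
  (forall i, (i < N)%N -> b i.+1 <= b i) ->
  (forall i, (i < N)%N -> 1 <= (d i.+1 - b i.+1) - (d i - b i)) ->
  2 <= M -> N.+1%:R <= M ->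
  (forall i, (i < N)%N -> d i.+1 <= M * b i) ->
  (forall i, (i < N)%N -> b i <= M * d i.+1) ->
  (forall i, 0 < phi i) ->
  \sum_(k < N.+1) nu k * (phi k * ln (phi k)) - (\sum_(k < N.+1) nu k * phi k)
      * ln ((\sum_(k < N.+1) nu k * phi k) / \sum_(k < N.+1) nu k)
  <= 20 * ln M * \sum_(k < N) nu k * b k * (Num.sqrt (phi k.+1) - Num.sqrt (phi k)) ^+ 2.
Proof.
move=> nu0 bal b0 bN d0 dN dm bm th M2 MN hM hM' p0.
set W := \sum_(k < N.+1) nu k; set P := \sum_(k < N.+1) nu k * phi k.
have W0 : 0 < W.
  apply: (@lt_le_trans _ _ (nu 0%N)); first exact: nu0.
  rewrite /W big_ord_recl lerDl sumr_ge0 // => k _; rewrite ltW // nu0 // lift0.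
  exact: ltn_ord.
have P0 : 0 < P.
  apply: (@lt_le_trans _ _ (nu 0%N * phi 0%N)); first by rewrite mulr_gt0 // nu0.
  rewrite /P big_ord_recl lerDl sumr_ge0 // => k _; rewrite mulr_ge0 ?(ltW (p0 _)) //.
  rewrite ltW // nu0 // lift0; exact: ltn_ord.
pose m := P / W; have m0 : 0 < m by rewrite divr_gt0.
have sqrE k : Num.sqrt (phi k / m) = Num.sqrt (phi k) * Num.sqrt m^-1.
  by rewrite sqrtrM // ltW.
have h2 k : Num.sqrt (phi k / m) ^+ 2 = phi k / m.
  by rewrite sqr_sqrtr // divr_ge0 // ltW.
have := @lsi_1d_normalized N (fun k => nu k / W) d b (fun k => Num.sqrt (phi k / m)) M.
move=> /(_ _ _ b0 bN d0 dN dm bm th M2 MN hM hM' _ _ _) H.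
have {}H : \sum_(k < N.+1) nu k / W * (Num.sqrt (phi k / m) ^+ 2 * ln (Num.sqrt (phi k / m) ^+ 2))
  <= 20 * ln M * \sum_(k < N) nu k / W * b k
        * (Num.sqrt (phi k.+1 / m) - Num.sqrt (phi k / m)) ^+ 2.
  apply: H.
  - by move=> i iN; rewrite divr_gt0 ?nu0.
  - by move=> i iN; rewrite mulrAC bal // mulrAC.
  - by move=> i; exact: sqrtr_ge0.
  - by rewrite -mulr_suml divff // gt_eqF.
  - under eq_bigr do rewrite h2 mulrACA.
    by rewrite -mulr_suml -/P -invfM mulrC /m [W * _]mulrC divfK ?mulVf // gt_eqF.
have e1 : \sum_(k < N.+1) nu k / W * (Num.sqrt (phi k / m) ^+ 2 * ln (Num.sqrt (phi k / m) ^+ 2))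
   = (\sum_(k < N.+1) nu k * (phi k * ln (phi k)) - P * ln m) / P.
  have e k : nu k / W * (Num.sqrt (phi k / m) ^+ 2 * ln (Num.sqrt (phi k / m) ^+ 2))
    = (nu k * (phi k * ln (phi k)) - nu k * phi k * ln m) / P.
    rewrite h2 ln_div ?posrE // /m; field.
    by rewrite !gt_eqF.
  under eq_bigr do rewrite e.
  by rewrite -mulr_suml sumrB -mulr_suml.
have e2 : \sum_(k < N) nu k / W * b k * (Num.sqrt (phi k.+1 / m) - Num.sqrt (phi k / m)) ^+ 2
   = (\sum_(k < N) nu k * b k * (Num.sqrt (phi k.+1) - Num.sqrt (phi k)) ^+ 2) / P.
  rewrite mulr_suml; apply: eq_bigr => k _; rewrite !sqrE -mulrBl exprMn sqr_sqrtr ?invr_ge0 ?ltW //.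
  by rewrite /m; field; rewrite !gt_eqF.
by rewrite e1 e2 mulrA ler_pM2r ?invr_gt0 // in H.
Qed.

End OneDimensional.

(** * Configurations *)

Section Configurations.
Variable I : finType.
Implicit Types (A S : {set I}) (i j : I) (x y z : {ffun I -> nat}).

Definition put i k x : {ffun I -> nat} := [ffun j => (x j + k * (j == i))%N].

(** Both the set of sites and the number of particles vary in the induction; lists keep all
    configurations in a single type. *)
Definition conf A N : seq {ffun I -> nat} :=
  [seq [ffun i => nat_of_ord (c i)] |
     c : {ffun I -> 'I_N.+1} <- enum [pred c : {ffun I -> 'I_N.+1} |
       (\sum_i c i == N)%N && [forall i, (i \notin A) ==> (c i == 0 :> nat)]]].

Lemma mem_conf A N x :
  (x \in conf A N) = (\sum_i x i == N)%N && [forall i, (i \notin A) ==> (x i == 0)].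
Proof.
apply/mapP/andP => [[y]|[/eqP sx /forallP ax]].
  rewrite mem_enum inE => /andP[sy ay] ->; split.
    by under eq_bigr do rewrite ffunE.
  by apply/forallP => i; have /forallP/(_ i) := ay; rewrite ffunE.
have xi i : (x i < N.+1)%N by rewrite ltnS -sx (bigD1 i) //= leq_addr.
exists [ffun i => Ordinal (xi i)]; last by apply/ffunP => i; rewrite !ffunE.
rewrite mem_enum inE; apply/andP; split.
  by under eq_bigr do rewrite ffunE; rewrite sx.
by apply/forallP => i; rewrite ffunE /=; apply: ax.
Qed.

Lemma conf_uniq A N : uniq (conf A N).
Proof.
rewrite map_inj_uniq ?enum_uniq // => y y' /ffunP e.
by apply/ffunP => i; have := e i; rewrite !ffunE => /val_inj.
Qed.

Lemma conf_sum A N x : x \in conf A N -> (\sum_i x i)%N = N.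
Proof. by rewrite mem_conf => /andP[/eqP]. Qed.

Lemma conf_out A N x i : x \in conf A N -> i \notin A -> x i = 0%N.
Proof. by rewrite mem_conf => /andP[_ /forallP/(_ i)/implyP h] /h/eqP. Qed.

Lemma sum_put i k x : (\sum_j put i k x j = \sum_j x j + k)%N.
Proof.
under eq_bigr do rewrite ffunE; rewrite big_split /=; congr addn.
by rewrite (bigD1 i) //= eqxx muln1 big1 ?addn0 // => j /negPf ->; rewrite muln0.
Qed.

Lemma putC i j k l x : put i k (put j l x) = put j l (put i k x).
Proof. by apply/ffunP => a; rewrite !ffunE addnAC. Qed.

Lemma putD i k l x : put i k (put i l x) = put i (k + l) x.
Proof. by apply/ffunP => a; rewrite !ffunE mulnDl; lia. Qed.

Lemma put0 i x : put i 0 x = x.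
Proof. by apply/ffunP => a; rewrite !ffunE addn0. Qed.

Lemma put_inj i k : injective (put i k).
Proof.
by move=> x y /ffunP e; apply/ffunP => j; have := e j; rewrite !ffunE => /addIn.
Qed.

Lemma put_eq i k x : put i k x i = (x i + k)%N.
Proof. by rewrite ffunE eqxx muln1. Qed.

Lemma put_neq i j k x : j != i -> put i k x j = x j.
Proof. by move=> /negPf ji; rewrite ffunE ji muln0 addn0. Qed.

Lemma put_conf A N i k x : i \in A -> x \in conf A N -> put i k x \in conf A (N + k).
Proof.
move=> iA xA; rewrite mem_conf sum_put (conf_sum xA) eqxx /=.
apply/forallP => j; apply/implyP => jA.
by rewrite put_neq ?(conf_out xA) //; apply: contraNneq jA => ->.
Qed.

Lemma conf_put A N i k x : (k <= N)%N -> put i k x \in conf A N -> x \in conf A (N - k).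
Proof.
move=> kN; rewrite !mem_conf sum_put => /andP[/eqP e /forallP h].
apply/andP; split; first by apply/eqP; lia.
apply/forallP => j; have := h j; rewrite ffunE addn_eq0.
by case: (j \in A) => //= /andP[].
Qed.

Lemma put1_surj A N i x : x \in conf A N.+1 -> (0 < x i)%N ->
  exists2 z, z \in conf A N & x = put i 1 z.
Proof.
move=> xA xi; have e : x = put i 1 [ffun j => (x j - (j == i))%N].
  apply/ffunP => j; rewrite !ffunE mul1n subnK //.
  by case: eqVneq => // ->.
exists [ffun j => (x j - (j == i))%N] => //.
by have := xA; rewrite {1}e => /conf_put; rewrite subn1; apply.
Qed.

Lemma conf_gt0 A N x : x \in conf A N.+1 -> exists2 i, i \in A & (0 < x i)%N.
Proof.
move=> xA; have [i xi|h] := pickP (fun i => 0 < x i)%N.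
  exists i => //; apply: contraLR xi => iA.
  by rewrite (conf_out xA iA).
have := conf_sum xA; rewrite big1 // => i _; apply/eqP.
by have := h i; rewrite lt0n => /negbFE.
Qed.

Lemma conf0 A : conf A 0 = [:: [ffun => 0%N]].
Proof.
apply/perm_small_eq => //; apply: uniq_perm => //; first exact: conf_uniq.
move=> x; rewrite inE mem_conf; apply/andP/eqP => [[/eqP s _]|->].
  apply/ffunP => i; rewrite ffunE; apply/eqP; rewrite -leqn0 -s.
  by rewrite (bigD1 i) //= leq_addr.
split; first by rewrite big1 // => i _; rewrite ffunE.
by apply/forallP => i; rewrite ffunE eqxx implybT.
Qed.

Lemma conf_set1 i N : conf [set i] N = [:: put i N [ffun => 0%N]].
Proof.
apply/perm_small_eq => //; apply: uniq_perm => //; first exact: conf_uniq.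
move=> x; rewrite inE; apply/idP/eqP => [xA|->].
  apply/ffunP => j; rewrite ffunE ffunE add0n; case: eqVneq => [->|ji].
    rewrite muln1 -(conf_sum xA) (bigD1 i) //= big1 ?addn0 // => l li.
    by rewrite (conf_out xA) // inE.
  by rewrite muln0 (conf_out xA) // inE.
rewrite -[N in conf _ N]add0n; apply: put_conf; first by rewrite inE.
by rewrite conf0 inE.
Qed.

(** * Weights and partition functions *)

Section Sums.
Variable R : realType.
Implicit Type F : {ffun I -> nat} -> R.

Lemma sum_conf_put A N j F : j \in A ->
  \sum_(x <- conf A N.+1 | (0 < x j)%N) F x = \sum_(z <- conf A N) F (put j 1 z).
Proof.
move=> jA; rewrite -big_filter -(big_map (put j 1) predT F).
apply: perm_big; apply: uniq_perm.
- by rewrite filter_uniq // conf_uniq.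
- by rewrite map_inj_uniq ?conf_uniq //; exact: put_inj.
move=> x; rewrite mem_filter; apply/andP/mapP => [[xj xA]|[z zA ->]].
  by have [z zA ->] := put1_surj xA xj; exists z.
by rewrite put_eq addn1 ltn0Sn; have := put_conf 1 jA zA; rewrite addn1.
Qed.

Lemma sum_conf_site A N i F : i \in A ->
  \sum_(x <- conf A N) F x
  = \sum_(k < N.+1) \sum_(z <- conf (A :\ i) (N - k)) F (put i k z).
Proof.
move=> iA; pose s := [seq put i k z | k <- iota 0 N.+1, z <- conf (A :\ i) (N - k)].
have -> : \sum_(x <- conf A N) F x = \sum_(x <- s) F x.
  have ei k z : z \in conf (A :\ i) (N - k) -> put i k z i = k.
    by move=> zA; rewrite put_eq (conf_out zA) // !inE eqxx.
  apply: perm_big; apply: uniq_perm; first exact: conf_uniq.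
    apply: allpairs_uniq_dep => [|k _|]; [exact: iota_uniq|exact: conf_uniq|].
    move=> p q /allpairsPdep[k [z [_ zA ->]]] /allpairsPdep[k' [z' [_ zA' ->]]] /= e.
    have kk : k = k' by rewrite -(ei _ _ zA) -(ei _ _ zA') e.
    by move: zA' e; rewrite -kk => _ /put_inj ->.
  move=> x; apply/idP/allpairsPdep => [xA|[k [z [kN zA ->]]]].
    have xi : (x i <= N)%N by rewrite -(conf_sum xA) (bigD1 i) //= leq_addr.
    pose z : {ffun I -> nat} := [ffun j => if j == i then 0%N else x j].
    have e : x = put i (x i) z.
      apply/ffunP => j; rewrite !ffunE; case: eqVneq => [->|_].
        by rewrite muln1.
      by rewrite muln0 addn0.
    exists (x i), z; split=> //; first by rewrite mem_iota.
    have zA : z \in conf A (N - x i) by apply: (@conf_put _ _ i) => //; rewrite -e.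
    rewrite mem_conf (conf_sum zA) eqxx /=; apply/forallP => j; apply/implyP.
    rewrite !inE negb_and negbK => /orP[/eqP ->|jA]; first by rewrite ffunE eqxx.
    by rewrite (conf_out zA).
  rewrite mem_iota add0n ltnS /= in kN.
  have zA' : z \in conf A (N - k).
    rewrite mem_conf (conf_sum zA) eqxx /=; apply/forallP => j; apply/implyP => jA.
    by rewrite (conf_out zA) // !inE (negPf jA) andbF.
  by have := put_conf k iA zA'; rewrite subnK.
rewrite /s big_allpairs_dep /= -[in RHS](big_mkord predT
   (fun k => \sum_(z <- conf (A :\ i) (N - k)) F (put i k z))).
by rewrite /index_iota subn0.
Qed.

Variable r : I -> nat -> R.
Hypothesis r0 : forall i, r i 0%N = 0.
Hypothesis r_gt0 : forall i k, (1 <= k)%N -> 0 < r i k.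

Definition site_wt i k : R := \prod_(1 <= l < k.+1) (r i l)^-1.
Definition wt x : R := \prod_i site_wt i (x i).
Definition Zc A N : R := \sum_(x <- conf A N) wt x.

Lemma site_wt_gt0 i k : 0 < site_wt i k.
Proof.
rewrite /site_wt big_seq prodr_gt0 // => l; rewrite mem_index_iota => /andP[l1 _].
by rewrite invr_gt0 r_gt0.
Qed.

Lemma site_wt0 i : site_wt i 0 = 1.
Proof. by rewrite /site_wt big_geq. Qed.

Lemma site_wtS i k : site_wt i k.+1 * r i k.+1 = site_wt i k.
Proof.
by rewrite /site_wt big_nat_recr //= -mulrA mulVf ?mulr1 // gt_eqF // r_gt0.
Qed.

Lemma wt_gt0 x : 0 < wt x.
Proof. by rewrite prodr_gt0 // => i _; exact: site_wt_gt0. Qed.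

Lemma wt_put1 i x : wt (put i 1 x) * r i (put i 1 x i) = wt x.
Proof.
rewrite /wt (bigD1 i) //= [in RHS](bigD1 i) //= mulrAC put_eq addn1 site_wtS.
by congr (_ * _); apply: eq_bigr => j ji; rewrite put_neq.
Qed.

Lemma wt_put i k x : x i = 0%N -> wt (put i k x) = site_wt i k * wt x.
Proof.
move=> xi; rewrite /wt (bigD1 i) //= [in RHS](bigD1 i) //= put_eq xi add0n.
rewrite site_wt0 mul1r.
by congr (_ * _); apply: eq_bigr => j ji; rewrite put_neq.
Qed.

Lemma sum_wt_put A N j F : j \in A ->
  \sum_(x <- conf A N.+1) wt x * (r j (x j) * F x)
  = \sum_(z <- conf A N) wt z * F (put j 1 z).
Proof.
move=> jA; rewrite (bigID (fun x => 0 < x j)%N) /= [X in _ + X]big1 ?addr0.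
  rewrite sum_conf_put //; apply: eq_bigr => z _.
  by rewrite mulrA wt_put1.
by move=> x; rewrite -eqn0Ngt => /eqP ->; rewrite r0 mul0r mulr0.
Qed.

Lemma sum_wt_site A N i F : i \in A ->
  \sum_(x <- conf A N) wt x * F x
  = \sum_(k < N.+1) site_wt i k * \sum_(z <- conf (A :\ i) (N - k)) wt z * F (put i k z).
Proof.
move=> iA; rewrite (sum_conf_site _ _ iA); apply: eq_bigr => k _.
rewrite mulr_sumr big_seq [in RHS]big_seq; apply: eq_bigr => z zA.
by rewrite wt_put ?mulrA // (conf_out zA) // !inE eqxx.
Qed.

Lemma Zc_gt0 A N : A != set0 -> 0 < Zc A N.
Proof.
move=> /set0Pn[i iA].
have m : put i N [ffun => 0%N] \in conf A N.
  by rewrite -[N in conf _ N]add0n put_conf // conf0 inE.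
rewrite /Zc (bigD1_seq _ m (conf_uniq A N)) /= ltr_wpDr ?wt_gt0 //.
by apply: sumr_ge0 => x _; rewrite ltW // wt_gt0.
Qed.

End Sums.
End Configurations.

(** * Second class particle *)

Section Stationary.
Variables (R : realType) (U : eqType).

Lemma sum_indicator (s : seq U) (H : U -> R) (z : U) : uniq s -> z \in s ->
  \sum_(y <- s) (z == y)%:R * H y = H z.
Proof.
move=> us zs; rewrite (bigD1_seq z) //= eqxx mul1r big1 ?addr0 // => y /negPf yz.
by rewrite eq_sym yz mul0r.
Qed.

Lemma seq_argmax (s : seq U) (F : U -> R) (x0 : U) : x0 \in s ->
  exists2 x, x \in s & forall y, y \in s -> F y <= F x.
Proof.
elim: s x0 => // a s IH x0 _; case: s IH => [|a' s] IH.
  by exists a; rewrite ?mem_head // => y; rewrite inE => /eqP ->.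
have [x xs h] := IH a' (mem_head _ _); case: (leP (F a) (F x)) => ax.
  exists x => [|y]; first by rewrite inE xs orbT.
  by rewrite inE => /orP[/eqP ->|/h].
exists a; first exact: mem_head.
by move=> y; rewrite inE => /orP[/eqP -> //|/h yx]; apply: le_trans yx (ltW ax).
Qed.

(* The generator annihilates constants, so it has a nonzero left null vector;
   its absolute value is again a left null vector. *)
Lemma stationary_kernel (s : seq U) (x0 : U) (q : U -> U -> R) :
  uniq s -> x0 \in s ->
  (forall x y, x \in s -> y \in s -> x != y -> 0 <= q x y) ->
  (forall x, x \in s -> \sum_(y <- s) q x y = 0) ->
  exists o : U -> R, [/\ forall x, 0 <= o x, \sum_(x <- s) o x = 1 &
    forall y, y \in s -> \sum_(x <- s) o x * q x y = 0].
Proof.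
move=> us x0s q0 qs.
pose n := size s; pose M : 'M[R]_n := \matrix_(i, j) q (nth x0 s i) (nth x0 s j).
have sumE (F : U -> R) : \sum_(x <- s) F x = \sum_(i < n) F (nth x0 s i).
  by rewrite (big_nth x0) big_mkord.
have n0 : (0 < n)%N by rewrite /n; case: (s) x0s.
have M1 : M *m (const_mx 1 : 'cV_n) = 0.
  apply/colP => i; rewrite !mxE -[RHS](qs (nth x0 s i)) ?mem_nth // sumE.
  by apply: eq_bigr => j _; rewrite !mxE mulr1.
have kM : kermx M != 0.
  rewrite kermx_eq0; apply/negP; rewrite row_free_unit => uM.
  have : (const_mx 1 : 'cV[R]_n) = 0 by rewrite -[LHS](mulKmx uM) M1 mulmx0.
  by move/colP/(_ (Ordinal n0)); rewrite !mxE => /eqP; rewrite oner_eq0.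
pose v := nz_row (kermx M).
have v0 : v != 0 by rewrite nz_row_eq0.
have vM : v *m M = 0 by apply/sub_kermxP; exact: nz_row_sub.
pose a i := `|v 0 i|.
have col j : \sum_i v 0 i * M i j = 0.
  by have := congr1 (fun B : 'rV_n => B 0 j) vM; rewrite !mxE.
(* In the equation for [v] the nonpositive diagonal term balances the others, which the triangle
   inequality bounds. *)
have ge j : 0 <= \sum_i a i * M i j.
  rewrite (bigD1 j) //=; have := col j; rewrite (bigD1 j) //= => /eqP.
  rewrite addrC addr_eq0 => /eqP e.
  have Mj : M j j <= 0.
    have : \sum_(i < n) M j i = 0.
      by rewrite -[RHS](qs (nth x0 s j)) ?mem_nth // sumE; apply: eq_bigr => i _; rewrite mxE.
    rewrite (bigD1 j) //= => /eqP; rewrite addr_eq0 => /eqP ->.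
    rewrite oppr_le0; apply: sumr_ge0 => i ij; rewrite mxE q0 ?mem_nth //.
    by rewrite nth_uniq // eq_sym.
  have : `|\sum_(i < n | i != j) v 0 i * M i j| <= \sum_(i < n | i != j) a i * M i j.
    apply: le_trans (ler_norm_sum _ _ _) _; apply: ler_sum => i ij.
    rewrite normrM ler_wpM2l // ger0_norm // mxE q0 ?mem_nth // nth_uniq //.
  by rewrite e normrN normrM (ler0_norm Mj) -/(a j) mulrN; lra.
(* The rows of [M] sum to 0, so these nonnegative column sums add up to 0 and all vanish. *)
have tot : \sum_j \sum_i a i * M i j = 0.
  rewrite exchange_big big1 //= => i _; rewrite -mulr_sumr.
  rewrite (_ : \sum_j _ = 0) ?mulr0 // -[RHS](qs (nth x0 s i)) ?mem_nth // sumE.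
  by apply: eq_bigr => j _; rewrite mxE.
have aM j : \sum_i a i * M i j = 0.
  have /psumr_eq0P h : forall j, true -> 0 <= \sum_i a i * M i j by [].
  exact: h.
have A0 : 0 < \sum_i a i.
  rewrite lt0r sumr_ge0 ?andbT; last by move=> i _; exact: normr_ge0.
  apply: contra v0 => /eqP/psumr_eq0P h; apply/eqP/rowP => i; rewrite mxE.
  by apply/eqP; rewrite -normr_eq0 -/(a i) h // => j _; exact: normr_ge0.
pose o x := if insub (index x s) is Some i then a i / (\sum_i a i) else 0.
have oE (i : 'I_n) : o (nth x0 s i) = a i / (\sum_i a i).
  by rewrite /o index_uniq // valK.
exists o; split.
- move=> x; rewrite /o; case: insubP => // i _ _.
  by rewrite divr_ge0 ?normr_ge0 // ltW.
- by rewrite sumE; under eq_bigr do rewrite oE; rewrite -mulr_suml divff // gt_eqF.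
move=> y ys; rewrite sumE; under eq_bigr do rewrite oE.
have yn : (index y s < n)%N by rewrite index_mem.
transitivity ((\sum_i a i * M i (Ordinal yn)) / (\sum_i a i)); last by rewrite aM mul0r.
rewrite mulr_suml; apply: eq_bigr => i _; rewrite mxE /= nth_index //; ring.
Qed.

(** The chain is given by moves: [u] leads from [x] to [tau x u] at rate [c x u], and must stay in
    [s] only when that rate is nonzero. Invariance is tested against all functions. *)
Lemma stationary_moves (J : finType) (s : seq U) (x0 : U)
    (c : U -> J -> R) (tau : U -> J -> U) :
  uniq s -> x0 \in s ->
  (forall x u, x \in s -> 0 <= c x u) ->
  (forall x u, x \in s -> c x u != 0 -> tau x u \in s) ->
  exists o : U -> R, [/\ forall x, 0 <= o x, \sum_(x <- s) o x = 1 &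
    forall H : U -> R,
      \sum_(x <- s) o x * \sum_u c x u * (H (tau x u) - H x) = 0].
Proof.
move=> us x0s c0 cs.
pose q x y := \sum_u c x u * ((tau x u == y)%:R - (x == y)%:R).
have qH (H : U -> R) x : x \in s ->
    \sum_(y <- s) q x y * H y = \sum_u c x u * (H (tau x u) - H x).
  move=> xs; rewrite /q; under eq_bigr do rewrite mulr_suml.
  rewrite exchange_big /=; apply: eq_bigr => u _.
  have [->|cu] := eqVneq (c x u) 0.
    by rewrite mul0r big1 // => y _; rewrite !mul0r.
  under eq_bigr do rewrite -mulrA mulrBl mulrBr.
  by rewrite sumrB -!mulr_sumr !sum_indicator ?cs // mulrBr.
have [||o [o0 o1 oq]] := @stationary_kernel s x0 q us x0s.
- move=> x y xs ys xy; apply: sumr_ge0 => u _.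
  by rewrite (negPf xy) subr0 mulr_ge0 ?c0.
- move=> x xs; have := qH (fun=> 1) x xs; under eq_bigr do rewrite mulr1.
  by move=> ->; rewrite big1 // => u _; rewrite subrr mulr0.
exists o; split=> // H.
transitivity (\sum_(y <- s) H y * \sum_(x <- s) o x * q x y).
  under [RHS]eq_bigr do rewrite mulr_sumr.
  rewrite exchange_big /= big_seq [RHS]big_seq; apply: eq_bigr => x xs.
  rewrite -qH // mulr_sumr; apply: eq_bigr => y _; ring.
by rewrite big_seq big1 // => y ys; rewrite oq // mulr0.
Qed.

End Stationary.

(** * Reversibility, irreducibility and the coupling of [N] with [N.+1] particles *)

Section Coupling.
Variables (I : finType) (R : realType) (r : I -> nat -> R).
Hypothesis r0 : forall i, r i 0%N = 0.
Hypothesis r_gt0 : forall i k, (1 <= k)%N -> 0 < r i k.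
Implicit Types (A : {set I}) (i j k : I) (x y z : {ffun I -> nat}).
Implicit Types F G : {ffun I -> nat} -> R.

Local Notation w := (wt r).
Let wp x : 0 < w x.
Proof. exact: wt_gt0. Qed.

Definition remove1 i x : {ffun I -> nat} := [ffun j => (x j - (j == i))%N].
Definition jump i k x := put k 1 (remove1 i x).

(** The zero-range generator on the complete graph over [A], without the factor [1 / #|A|]. *)
Definition gen A F x : R :=
  \sum_(i in A) \sum_(k in A) r i (x i) * (F (jump i k x) - F x).

Lemma remove1_put i x : remove1 i (put i 1 x) = x.
Proof. by apply/ffunP => j; rewrite !ffunE mul1n addnK. Qed.

Lemma jump_put i k x : jump i k (put i 1 x) = put k 1 x.
Proof. by rewrite /jump remove1_put. Qed.

Lemma r_neq0 i n : r i n != 0 -> (0 < n)%N.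
Proof. by case: n => //; rewrite r0 eqxx. Qed.

Lemma r_ge0 i n : 0 <= r i n.
Proof. by case: n => [|n]; rewrite ?r0 // ltW // r_gt0. Qed.

Lemma jump_conf A N i k x : k \in A -> x \in conf A N -> r i (x i) != 0 ->
  jump i k x \in conf A N.
Proof.
move=> kA xA /r_neq0 xi; case: N xA => [|N] xA.
  by have := conf_sum xA; rewrite (bigD1 i) //=; lia.
have [z zA ->] := put1_surj xA xi; rewrite jump_put -(addn1 N); exact: put_conf.
Qed.

(** With [x = put i 1 z], a jump from [i] to [k] joins [put i 1 z] to [put k 1 z]; exchanging [i]
    and [k] then gives symmetry and the energy formula. *)
Lemma gen_form A N F G :
  \sum_(x <- conf A N.+1) w x * (F x * gen A G x)
  = \sum_(i in A) \sum_(k in A) \sum_(z <- conf A N)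
      w z * (F (put i 1 z) * (G (put k 1 z) - G (put i 1 z))).
Proof.
under eq_bigr do rewrite mulr_sumr mulr_sumr.
rewrite exchange_big /=; apply: eq_bigr => i iA.
under eq_bigr do rewrite mulr_sumr mulr_sumr.
rewrite exchange_big /=; apply: eq_bigr => k kA.
have E := sum_wt_put r0 r_gt0 N (fun x => F x * (G (jump i k x) - G x)) iA.
transitivity (\sum_(x <- conf A N.+1) w x * (r i (x i) * (F x * (G (jump i k x) - G x)))).
  by apply: eq_bigr => x _; ring.
rewrite E.
by apply: eq_bigr => z _; rewrite jump_put.
Qed.

Lemma gen_conf0 A F x : x \in conf A 0 -> gen A F x = 0.
Proof.
rewrite conf0 inE => /eqP ->; rewrite /gen big1 // => i _; rewrite big1 // => k _.
by rewrite ffunE r0 mul0r.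
Qed.

Lemma gen_sym A N F G :
  \sum_(x <- conf A N) w x * (F x * gen A G x)
  = \sum_(x <- conf A N) w x * (G x * gen A F x).
Proof.
case: N => [|N].
  by rewrite big_seq [RHS]big_seq; apply: eq_bigr => x xA; rewrite !gen_conf0 // !mulr0.
rewrite !gen_form; apply/eqP; rewrite -subr_eq0 -sumrB; apply/eqP.
transitivity (\sum_(i in A) \sum_(k in A)
   (\sum_(z <- conf A N) w z * (F (put i 1 z) * G (put k 1 z))
    - \sum_(z <- conf A N) w z * (F (put k 1 z) * G (put i 1 z)))).
  apply: eq_bigr => i _; rewrite -sumrB; apply: eq_bigr => k _.
  rewrite -!sumrB; apply: eq_bigr => z _; ring.
under eq_bigr do rewrite sumrB.
by rewrite sumrB [X in _ - X]exchange_big subrr.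
Qed.

Lemma gen_energy A N G :
  \sum_(x <- conf A N.+1) w x * (G x * gen A G x)
  = - (2^-1 * \sum_(i in A) \sum_(k in A) \sum_(z <- conf A N)
      w z * (G (put k 1 z) - G (put i 1 z)) ^+ 2).
Proof.
rewrite gen_form; set X := LHS.
have e : X + X = - \sum_(i in A) \sum_(k in A) \sum_(z <- conf A N)
      w z * (G (put k 1 z) - G (put i 1 z)) ^+ 2.
  rewrite {2}/X exchange_big /= -big_split /= -sumrN; apply: eq_bigr => i _.
  rewrite -big_split /= -sumrN; apply: eq_bigr => k _.
  rewrite -big_split /= -sumrN; apply: eq_bigr => z _; ring.
lra.
Qed.

(** Irreducibility: zero energy means that [G] is unchanged when one particle moves, and all
    particles can be gathered at one site. *)
Lemma gen_null_const A N G :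
  \sum_(x <- conf A N) w x * (G x * gen A G x) = 0 ->
  exists a, forall x, x \in conf A N -> G x = a.
Proof.
case: N => [|N] h.
  by exists (G [ffun => 0%N]) => x; rewrite conf0 inE => /eqP ->.
have [->|/set0Pn[i0 i0A]] := eqVneq A set0.
  by exists 0 => x /conf_gt0 [i]; rewrite inE.
have e z i k : z \in conf A N -> i \in A -> k \in A -> G (put k 1 z) = G (put i 1 z).
  move=> zA iA kA; move: h; rewrite gen_energy => /eqP.
  have T0 i' k' z' : 0 <= w z' * (G (put k' 1 z') - G (put i' 1 z')) ^+ 2.
    by rewrite mulr_ge0 ?sqr_ge0 // ltW.
  rewrite oppr_eq0 mulf_eq0 invr_eq0 pnatr_eq0 /= => /eqP.
  move/psumr_eq0P => /(_ (fun i _ => sumr_ge0 _ (fun k _ => sumr_ge0 _ (fun z _ => T0 i k z)))).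
  move=> /(_ i iA) /psumr_eq0P => /(_ (fun k _ => sumr_ge0 _ (fun z _ => T0 i k z))).
  move=> /(_ k kA) /eqP; rewrite psumr_eq0 // => /allP /(_ z zA) /=.
  by rewrite mulf_eq0 gt_eqF //= sqrf_eq0 subr_eq0 => /eqP.
exists (G (put i0 N.+1 [ffun => 0%N])).
(* [M] counts the particles still to be gathered at [i0]. *)
have key M z : (M <= N.+1)%N -> z \in conf A M ->
    G (put i0 (N.+1 - M) z) = G (put i0 N.+1 [ffun => 0%N]).
  elim: M z => [|M IH] z MN zA.
    by rewrite subn0; move: zA; rewrite conf0 inE => /eqP ->.
  have [i iA zi] := conf_gt0 zA; have [z' zA' ->] := put1_surj zA zi.
  rewrite -(IH z' (ltnW MN) zA') subSS.
  have -> : (N.+1 - M = 1 + (N - M))%N by lia.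
  rewrite -putD putC.
  apply: e => //; rewrite -[N in conf A N](subnKC (MN : (M <= N)%N)).
  exact: put_conf.
by move=> x xA; rewrite -(key _ _ (leqnn _) xA) subnn put0.
Qed.

(** Stationarity tested on the density [rho / w] says that this density has zero energy. *)
Lemma stationary_unique A N (rho : {ffun I -> nat} -> R) : A != set0 ->
  \sum_(x <- conf A N) rho x = 1 ->
  (forall F, \sum_(x <- conf A N) rho x * gen A F x = 0) ->
  forall x, x \in conf A N -> rho x = w x / Zc r A N.
Proof.
move=> A0 rho1 h.
have [|a ha] := @gen_null_const A N (fun x => rho x / w x).
  rewrite -[RHS](h (fun x => rho x / w x)); apply: eq_bigr => x _.
  by rewrite mulrA mulrC [w x * _]mulrC divfK ?gt_eqF // mulrC.
have rE x : x \in conf A N -> rho x = a * w x.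
  by move=> xA; rewrite -(ha x xA) divfK // gt_eqF.
have aZ : a * Zc r A N = 1.
  by rewrite -rho1 /Zc mulr_sumr big_seq [RHS]big_seq; apply: eq_bigr => x /rE.
have Z0 := Zc_gt0 r_gt0 N A0.
by move=> x xA; rewrite rE // -[a](mulfK (lt0r_neq0 Z0)) aZ mul1r mulrC.
Qed.

Variables (delta Delta : R).
Hypothesis delta_gt0 : 0 < delta.
Hypothesis hr : forall i (k : nat), delta <= r i k.+1 - r i k /\ r i k.+1 - r i k <= Delta.

Let gap j x := r j (x j).+1 - r j (x j).

(* The second class particle sits at [j] on top of the configuration [x]; it is
   relocated at rate [r j (x j + 1) - r j (x j)], so that [put j 1 x] also evolves
   as a zero-range process. *)
Definition second_class_gen A (H : {ffun I -> nat} * I -> R) x j : R :=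
  gen A (fun y => H (y, j)) x + \sum_(k in A) gap j x * (H (x, k) - H (x, j)).

(** The departure rate from [j] in [put j 1 x] is the sum of [r j (x j)] and of the gap, and the
    superposition reached is the same whichever of the two classes leaves [j]. *)
Lemma second_class_put A F x j : j \in A ->
  second_class_gen A (fun p => F (put p.2 1 p.1)) x j = gen A F (put j 1 x).
Proof.
move=> jA; rewrite /second_class_gen /gen /= (bigD1 j) //= [RHS](bigD1 j) //=.
rewrite addrAC -big_split /=; congr (_ + _).
  apply: eq_bigr => k kA; rewrite jump_put put_eq addn1 /gap.
  have e : r j (x j) * F (put j 1 (jump j k x)) = r j (x j) * F (put k 1 x).
    case: (posnP (x j)) => [->|xj]; first by rewrite r0 !mul0r.
    congr (_ * F _); rewrite /jump putC; congr put.
    by apply/ffunP => i; rewrite !ffunE mul1n subnK //; case: eqVneq => [->|].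
  rewrite mulrBr e; ring.
apply: eq_bigr => i /andP[_ ij]; apply: eq_bigr => k kA; rewrite put_neq //.
case: (posnP (x i)) => [->|xi]; first by rewrite r0 !mul0r.
congr (_ * (F _ - _)); rewrite /jump putC; congr put.
apply/ffunP => l; rewrite !ffunE mul1n.
by case: (eqVneq l i) => [->|_] /=; lia.
Qed.

Let states A N := [seq (x, j) | x <- conf A N, j <- enum A].

Lemma mem_states A N x j :
  ((x, j) \in states A N) = (x \in conf A N) && (j \in A).
Proof.
apply/allpairsP/andP => [[[y k] /= [yA]]|[xA jA]].
  by rewrite mem_enum => kA [-> ->].
by exists (x, j); rewrite mem_enum.
Qed.

Lemma sum_states A N (H : {ffun I -> nat} * I -> R) :
  \sum_(p <- states A N) H p = \sum_(x <- conf A N) \sum_(j in A) H (x, j).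
Proof. by rewrite big_allpairs; apply: eq_bigr => x _; rewrite big_enum. Qed.

Lemma second_class_stationary A N : A != set0 ->
  exists o : {ffun I -> nat} * I -> R, [/\ forall p, 0 <= o p,
    \sum_(x <- conf A N) \sum_(j in A) o (x, j) = 1 &
    forall H, \sum_(x <- conf A N) \sum_(j in A) o (x, j) * second_class_gen A H x j = 0].
Proof.
move=> /set0Pn[i0 i0A].
have us : uniq (states A N).
  apply: allpairs_uniq; [exact: conf_uniq|exact: enum_uniq|].
  by move=> [? ?] [? ?] _ _ /= [-> ->].
have xs : (put i0 N [ffun => 0%N], i0) \in states A N.
  by rewrite mem_states i0A andbT -[N in conf _ N]add0n put_conf // conf0 inE.
(* [inl (i, k)] is a first class jump and [inr k] a relocation of the second class particle. *)
pose c (p : {ffun I -> nat} * I) (u : I * I + I) : R := match u with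
  | inl (i, k) => if (i \in A) && (k \in A) then r i (p.1 i) else 0
  | inr k => if k \in A then gap p.2 p.1 else 0 end.
pose tau (p : {ffun I -> nat} * I) (u : I * I + I) := match u with
  | inl (i, k) => (jump i k p.1, p.2)
  | inr k => (p.1, k) end.
have [||o [o0 o1 oH]] := @stationary_moves R _ _ (states A N) _ c tau us xs.
- move=> [x j] [[i k]|k] _ /=; case: ifP => // _; first exact: r_ge0.
  by have [h _] := hr j (x j); apply: le_trans h; exact: ltW.
- move=> [x j] [[i k]|k]; rewrite mem_states => /andP[xA jA] /=; rewrite mem_states.
    case: ifP => [/andP[iA kA] ri|_]; last by rewrite eqxx.
    by rewrite jA andbT jump_conf.
  by case: ifP => [kA _|_]; rewrite ?xA ?eqxx.
exists o; split=> //; first by rewrite -(sum_states A N o).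
move=> H; rewrite -[RHS](oH H) sum_states; apply: eq_bigr => x _; apply: eq_bigr => j _.
congr (_ * _); rewrite big_sumType /= /second_class_gen /gen; congr (_ + _).
  rewrite pair_big /= [LHS]big_mkcond /=; apply: eq_bigr => -[i k] _ /=.
  by case: ifP => // _; rewrite mul0r.
by rewrite [LHS]big_mkcond; apply: eq_bigr => k _ /=; case: ifP => // _; rewrite mul0r.
Qed.

(** [P] is the stationary law [o] of the pair divided by [w], so [Zc r A N * P x j] is the
    probability that the extra particle is at [j] given [x]. Without the second class particle, or
    with it merged by [put], the pair evolves as a zero-range process; [stationary_unique]
    identifies both images of [o]. *)
Lemma coupling A N : A != set0 ->
  exists P : {ffun I -> nat} -> I -> R,
  [/\ forall x j, 0 <= P x j,
      forall x, x \in conf A N -> \sum_(j in A) P x j = (Zc r A N)^-1,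
      forall F, \sum_(x <- conf A N) w x * (\sum_(j in A) P x j * F (put j 1 x))
        = (\sum_(y <- conf A N.+1) w y * F y) / Zc r A N.+1 &
      forall x j, x \in conf A N -> j \in A ->
        P x j <= Delta / delta / #|A|%:R / Zc r A N].
Proof.
move=> A0; have [o [o0 o1 oH]] := second_class_stationary N A0.
have Z0 M := Zc_gt0 r_gt0 M A0.
pose P x j := o (x, j) / w x.
have oP x j : o (x, j) = w x * P x j by rewrite /P mulrC divfK // gt_eqF.
have marg x : x \in conf A N -> \sum_(j in A) o (x, j) = w x / Zc r A N.
  move: x; apply: (@stationary_unique A N (fun x => \sum_(j in A) o (x, j))) => // F.
  rewrite -[RHS](oH (fun p => F p.1)); apply: eq_bigr => x' _.
  rewrite mulr_suml; apply: eq_bigr => j _; congr (_ * _).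
  rewrite /second_class_gen /= [X in _ + X]big1 ?addr0 // => k _.
  by rewrite subrr mulr0.
have margP x : x \in conf A N -> \sum_(j in A) P x j = (Zc r A N)^-1.
  by move=> xA; rewrite -mulr_suml marg // mulrAC divff ?mul1r // gt_eqF.
exists P; split=> //.
- by move=> x j; rewrite divr_ge0 // ltW.
- move=> F.
  pose nu y := \sum_(x <- conf A N) \sum_(j in A) o (x, j) * (put j 1 x == y)%:R.
  have nuF G : \sum_(y <- conf A N.+1) nu y * G y
      = \sum_(x <- conf A N) \sum_(j in A) o (x, j) * G (put j 1 x).
    under eq_bigr do rewrite mulr_suml; rewrite exchange_big /=.
    rewrite big_seq [RHS]big_seq; apply: eq_bigr => x xA.
    under eq_bigr do rewrite mulr_suml; rewrite exchange_big /=.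
    apply: eq_bigr => j jA.
    under eq_bigr do rewrite -mulrA; rewrite -mulr_sumr sum_indicator //.
      exact: conf_uniq.
    by have := put_conf 1 jA xA; rewrite addn1.
  have nuE : forall y, y \in conf A N.+1 -> nu y = w y / Zc r A N.+1.
    apply: (@stationary_unique A N.+1 nu) => //.
      rewrite -[RHS]o1; have := nuF (fun=> 1); under eq_bigr do rewrite mulr1.
      by move=> ->; apply: eq_bigr => x _; apply: eq_bigr => j _; rewrite mulr1.
    move=> G; rewrite nuF -[RHS](oH (fun p => G (put p.2 1 p.1))).
    apply: eq_bigr => x _; apply: eq_bigr => j jA.
    by rewrite second_class_put.
  transitivity (\sum_(y <- conf A N.+1) nu y * F y).
    rewrite nuF; apply: eq_bigr => x _; rewrite mulr_sumr; apply: eq_bigr => j _.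
    by rewrite oP mulrA.
  rewrite big_seq mulr_suml [RHS]big_seq; apply: eq_bigr => y /nuE ->.
  by rewrite mulrAC.
have [i0 i0A] := set0Pn _ A0.
have x0A : put i0 N [ffun => 0%N] \in conf A N.
  by rewrite -[N in conf _ N]add0n put_conf // conf0 inE.
have x0s : (put i0 N [ffun => 0%N], i0) \in states A N by rewrite mem_states x0A.
have [[xm jm] ms hmax] := seq_argmax (fun p => P p.1 p.2) x0s.
have [xmA jmA] : xm \in conf A N /\ jm \in A by apply/andP; rewrite -mem_states.
suff bound : P xm jm <= Delta / delta / #|A|%:R / Zc r A N.
  move=> x j xA jA; apply: le_trans bound.
  by have := hmax (x, j); rewrite mem_states xA jA => /(_ isT).
(* Maximum principle: at a maximum of P the first class moves can only lower P. *)
have gen_le0 : gen A (fun y => P y jm) xm <= 0.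
  apply: sumr_le0 => i iA; apply: sumr_le0 => k kA.
  have [->|ri] := eqVneq (r i (xm i)) 0; first by rewrite mul0r.
  rewrite mulr_ge0_le0 ?r_ge0 // subr_le0.
  have := hmax (jump i k xm, jm); rewrite mem_states jmA jump_conf //; exact.
(* Stationarity is tested on the indicator of the maximiser, and [gen_sym] transfers the first class
   generator to [P]. The remaining bracket is the inflow of the second class particle minus its
   outflow, both counting the relocation from [jm] to itself. *)
have bal : 0 = w xm * gen A (fun y => P y jm) xm
   + (\sum_(j in A) o (xm, j) * gap j xm - #|A|%:R * (o (xm, jm) * gap jm xm)).
  pose H (p : {ffun I -> nat} * I) : R := (p == (xm, jm))%:R.
  have HE x j : H (x, j) = (x == xm)%:R * (j == jm)%:R.
    by rewrite /H xpair_eqE -natrM mulnb.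
  have pick_x G : \sum_(x <- conf A N) (x == xm)%:R * G x = G xm.
    under eq_bigr do rewrite eq_sym.
    by rewrite sum_indicator // conf_uniq.
  rewrite -[LHS](oH H).
  transitivity (\sum_(x <- conf A N) \sum_(j in A) o (x, j) * gen A (fun y => H (y, j)) x
     + \sum_(x <- conf A N) \sum_(j in A) \sum_(k in A) o (x, j) * (gap j x * (H (x, k) - H (x, j)))).
    rewrite -big_split /=; apply: eq_bigr => x _; rewrite -big_split /=.
    by apply: eq_bigr => j _; rewrite /second_class_gen mulrDr mulr_sumr.
  congr (_ + _).
    rewrite exchange_big /= (bigD1 jm) //= [X in _ + X]big1 ?addr0.
      under eq_bigr do rewrite oP -mulrA.
      rewrite gen_sym -[RHS](pick_x (fun x => w x * gen A (fun y => P y jm) x)).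
      by apply: eq_bigr => x _; rewrite HE eqxx mulr1; ring.
    move=> j /andP[_ /negPf jj]; rewrite big1 // => x _.
    rewrite /gen big1 ?mulr0 // => i _; rewrite big1 // => k _.
    by rewrite !HE jj !mulr0 subrr mulr0.
  rewrite -[RHS](pick_x (fun x => \sum_(j in A) o (x, j) * gap j x
     - #|A|%:R * (o (x, jm) * gap jm x))).
  apply: eq_bigr => x _; set e := (x == xm)%:R.
  have sumH : \sum_(k in A) (k == jm)%:R = 1 :> R.
    by rewrite (bigD1 jm) //= eqxx big1 ?addr0 // => k /andP[_ /negPf ->].
  transitivity (\sum_(j in A) (e * (o (x, j) * gap j x)
     - #|A|%:R * e * ((j == jm)%:R * (o (x, j) * gap j x)))).
    apply: eq_bigr => j jA; under eq_bigr do rewrite !HE -/e.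
    rewrite -!mulr_sumr sumrB sumr_const -mulr_sumr sumH -[X in _ - X]mulr_natl; ring.
  have pick_j : \sum_(j in A) (j == jm)%:R * (o (x, j) * gap j x) = o (x, jm) * gap jm x.
    rewrite (bigD1 jm) //= eqxx mul1r big1 ?addr0 // => j /andP[_ /negPf ->].
    by rewrite mul0r.
  by rewrite sumrB -!mulr_sumr pick_j; ring.
have Ap : 0 < #|A|%:R :> R by rewrite ltr0n card_gt0.
have h1 : \sum_(j in A) o (xm, j) * gap j xm <= Delta * (w xm / Zc r A N).
  rewrite -marg // mulr_sumr; apply: ler_sum => j _; rewrite mulrC ler_wpM2r //.
  by have [] := hr j (xm j).
have h2 : o (xm, jm) * delta <= o (xm, jm) * gap jm xm.
  by rewrite ler_wpM2l //; have [] := hr jm (xm jm).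
have h3 : w xm * gen A (fun y => P y jm) xm <= 0 by rewrite mulr_ge0_le0 // ltW.
have h4 : #|A|%:R * (o (xm, jm) * delta) <= Delta * (w xm / Zc r A N).
  apply: le_trans (ler_wpM2l (ltW Ap) h2) _; lra.
rewrite /P ler_pdivrMr //.
have -> : Delta / delta / #|A|%:R / Zc r A N * w xm
  = Delta * (w xm / Zc r A N) / (#|A|%:R * delta).
  by field; rewrite !gt_eqF.
by rewrite ler_pdivlMr ?mulr_gt0 //; lra.
Qed.

End Coupling.

(** * Induction on the number of sites *)

Section Recursion.
Variables (I : finType) (R : realType) (r : I -> nat -> R).
Hypothesis r0 : forall i, r i 0%N = 0.
Hypothesis r_gt0 : forall i k, (1 <= k)%N -> 0 < r i k.
Variables (delta Delta : R).
Hypothesis delta_gt0 : 0 < delta.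
Hypothesis hr : forall i (k : nat), delta <= r i k.+1 - r i k /\ r i k.+1 - r i k <= Delta.
Implicit Types (A S : {set I}) (i j : I) (x y z : {ffun I -> nat}).
Implicit Types f g h : {ffun I -> nat} -> R.

Local Notation w := (wt r).
Local Notation Z := (Zc r).

Let wp x : 0 < w x.
Proof. exact: wt_gt0. Qed.

Let Z0 A N : A != set0 -> 0 < Z A N.
Proof. exact: Zc_gt0. Qed.

Lemma sum_wt_gt0 A N f : A != set0 -> (forall x, 0 < f x) ->
  0 < \sum_(x <- conf A N) w x * f x.
Proof.
move=> /set0Pn[i iA] f0.
have m : put i N [ffun => 0%N] \in conf A N.
  by rewrite -[N in conf _ N]add0n put_conf // conf0 inE.
rewrite (bigD1_seq _ m (conf_uniq A N)) /= ltr_wpDr ?mulr_gt0 //.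
by apply: sumr_ge0 => x _; rewrite mulr_ge0 // ltW.
Qed.

Lemma rate_bounds i n : delta * n%:R <= r i n /\ r i n <= Delta * n%:R.
Proof.
elim: n => [|n [h1 h2]]; first by rewrite r0 !mulr0 lexx.
have [h3 h4] := hr i n; rewrite -natr1 !mulrDr !mulr1; split; lra.
Qed.

Lemma rate_mono i n p : (n <= p)%N -> r i n <= r i p.
Proof.
elim: p => [|p IH]; first by rewrite leqn0 => /eqP ->.
rewrite leq_eqVlt => /orP[/eqP -> //|/IH h].
apply: le_trans h _; have [h3 _] := hr i p.
by rewrite -subr_ge0; apply: le_trans h3; exact: ltW.
Qed.

Lemma sum_rate A N i : i \in A ->
  \sum_(x <- conf A N.+1) w x * r i (x i) = Z A N.
Proof.
move=> iA; have := sum_wt_put r0 r_gt0 N (fun=> 1) iA.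
by under eq_bigr do rewrite mulr1; under [in RHS]eq_bigr do rewrite mulr1.
Qed.

(** The rates of [N.+1] particles add up to between [delta * N.+1%:R] and [Delta * N.+1%:R]; this is
    averaged with [sum_rate]. *)
Lemma Zc_ratio_bounds A N :
  delta * N.+1%:R * Z A N.+1 <= #|A|%:R * Z A N /\
  #|A|%:R * Z A N <= Delta * N.+1%:R * Z A N.+1.
Proof.
have -> : #|A|%:R * Z A N = \sum_(x <- conf A N.+1) w x * \sum_(i in A) r i (x i).
  under eq_bigr do rewrite mulr_sumr; rewrite exchange_big /=.
  rewrite mulr_natl -sumr_const; apply: eq_bigr => i iA.
  by rewrite sum_rate.
have sumA x : x \in conf A N.+1 -> \sum_(i in A) (x i)%:R = N.+1%:R :> R.
  move=> xA; rewrite -(conf_sum xA) natr_sum [LHS]big_mkcond /=.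
  by apply: eq_bigr => i _; case: ifPn => // /(conf_out xA) ->.
have ineq x : x \in conf A N.+1 ->
    delta * N.+1%:R <= \sum_(i in A) r i (x i) /\ \sum_(i in A) r i (x i) <= Delta * N.+1%:R.
  move=> xA; rewrite -(sumA x xA) !mulr_sumr.
  by split; apply: ler_sum => i _; have [] := rate_bounds i (x i).
by split; rewrite /Zc mulr_sumr big_seq [leRHS]big_seq; apply: ler_sum => x /ineq[h1 h2];
  rewrite [_ * w x]mulrC ler_wpM2l ?(ltW (wp x)).
Qed.

(** The ratios are the mean of [r i (x i)] with [N.+1] and with [N.+2] particles, and the particle
    added by the coupling can only raise the rate. *)
Lemma Zc_ratio_mono A N : A != set0 -> Z A N / Z A N.+1 <= Z A N.+1 / Z A N.+2.
Proof.
move=> A0; have [i iA] := set0Pn _ A0.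
have [P [P0 P1 PF _]] := coupling r0 r_gt0 delta_gt0 hr N.+1 A0.
have := PF (fun x => r i (x i)); rewrite sum_rate // => <-.
rewrite -[X in X / _](sum_rate N iA) mulr_suml big_seq [leRHS]big_seq.
apply: ler_sum => x xA; rewrite -mulrA ler_wpM2l ?(ltW (wp x)) //.
rewrite -(P1 x xA) mulr_sumr; apply: ler_sum => j _; rewrite mulrC ler_wpM2l //.
by apply: rate_mono; rewrite ffunE leq_addr.
Qed.

(** The coupling expresses both means over the same pairs [(x, j)]; after Cauchy-Schwarz, the
    uniform bound on [P] replaces it by a constant. *)
Lemma coupling_energy A N f g : A != set0 ->
  (forall x, 0 < f x) -> (forall x, 0 < g x) ->
  Z A N * (Num.sqrt ((\sum_(x <- conf A N) w x * f x) / Z A N)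
   - Num.sqrt ((\sum_(x <- conf A N.+1) w x * g x) / Z A N.+1)) ^+ 2
  <= Delta / delta / #|A|%:R * \sum_(x <- conf A N) w x *
      \sum_(j in A) (Num.sqrt (f x) - Num.sqrt (g (put j 1 x))) ^+ 2.
Proof.
move=> A0 f0 g0.
have [P [P0 P1 PF Pb]] := coupling r0 r_gt0 delta_gt0 hr N A0.
have pos M (h : {ffun I -> nat} -> R) : (forall x, 0 < h x) ->
    0 < (\sum_(x <- conf A M) w x * h x) / Z A M.
  by move=> h0; rewrite divr_gt0 ?Z0 // sum_wt_gt0.
set a := _ / Z A N; set b := _ / Z A N.+1.
have a0 : 0 < a by exact: pos.
have b0 : 0 < b by exact: pos.
have aE : a = \sum_(x <- conf A N) w x * \sum_(j in A) P x j * f x.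
  rewrite /a mulr_suml big_seq [RHS]big_seq; apply: eq_bigr => x xA.
  by rewrite -mulr_suml P1 //; ring.
have bE : b = \sum_(x <- conf A N) w x * \sum_(j in A) P x j * g (put j 1 x).
  by rewrite PF.
pose s := Num.sqrt a; pose t := Num.sqrt b.
have s0 : 0 < s by rewrite sqrtr_gt0.
have t0 : 0 < t by rewrite sqrtr_gt0.
have s2 : s ^+ 2 = a by rewrite sqr_sqrtr // ltW.
have t2 : t ^+ 2 = b by rewrite sqr_sqrtr // ltW.
(* Cauchy-Schwarz for the coupling, in the form 2 u v <= (t / s) u^2 + (s / t) v^2. *)
have key : (s - t) ^+ 2 <= \sum_(x <- conf A N) w x *
      \sum_(j in A) P x j * (Num.sqrt (f x) - Num.sqrt (g (put j 1 x))) ^+ 2.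
  have -> : (s - t) ^+ 2 = (1 - t / s) * a + (1 - s / t) * b.
    by rewrite -s2 -t2; field; rewrite !gt_eqF.
  rewrite aE bE !mulr_sumr -big_split /=; apply: ler_sum => x _.
  rewrite !(mulrCA _ (w x)) -mulrDr ler_wpM2l ?(ltW (wp x)) //.
  rewrite !mulr_sumr -big_split /=; apply: ler_sum => j _.
  rewrite !(mulrCA _ (P x j)) -mulrDr ler_wpM2l //.
  rewrite -{1}(sqr_sqrtr (ltW (f0 x))) -{1}(sqr_sqrtr (ltW (g0 (put j 1 x)))).
  set v := Num.sqrt (f x); set u := Num.sqrt (g _).
  rewrite -subr_ge0.
  have -> : (v - u) ^+ 2 - ((1 - t / s) * v ^+ 2 + (1 - s / t) * u ^+ 2)
     = (t * v - s * u) ^+ 2 / (s * t).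
    by field; rewrite !gt_eqF.
  by rewrite divr_ge0 ?sqr_ge0 // ltW // mulr_gt0.
rewrite -/s -/t mulrC -ler_pdivlMr ?Z0 //; apply: le_trans key _.
rewrite mulrAC mulr_sumr big_seq [leRHS]big_seq; apply: ler_sum => x xA.
rewrite mulrCA ler_wpM2l ?(ltW (wp x)) // mulr_sumr; apply: ler_sum => j jA.
by rewrite ler_wpM2r ?sqr_ge0 // Pb.
Qed.

(* The edges between configurations of N.+1 particles are the pairs
   (put i 1 z, put j 1 z) where z has N particles. *)
Definition edge A N f i j : R :=
  \sum_(z <- conf A N) w z * (Num.sqrt (f (put i 1 z)) - Num.sqrt (f (put j 1 z))) ^+ 2.

Definition edges A N f : R := \sum_(i in A) \sum_(j in A) edge A N f i j.

(** The entropy multiplied by [Z A N], which spares conditional probabilities in the decomposition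
    along a site. *)
Definition ent A N f : R :=
  \sum_(x <- conf A N) w x * (f x * ln (f x))
  - (\sum_(x <- conf A N) w x * f x) * ln ((\sum_(x <- conf A N) w x * f x) / Z A N).

Lemma edge_sym A N f i j : edge A N f i j = edge A N f j i.
Proof. by apply: eq_bigr => z _; rewrite -sqrrN opprB. Qed.

Lemma edge_diag A N f i : edge A N f i i = 0.
Proof. by rewrite /edge big1 // => z _; rewrite subrr expr2 !mulr0. Qed.

Lemma ent_single A N f x : (forall x, 0 < f x) -> conf A N = [:: x] -> ent A N f = 0.
Proof.
move=> f0 e; rewrite /ent /Zc e !big_seq1 [w x * f x]mulrC mulfK ?gt_eqF //; ring.
Qed.

Lemma edge_site S N f i j l : i \in S ->
  edge S N f j l
  = \sum_(k < N.+1) site_wt r i k * edge (S :\ i) (N - k) (fun z => f (put i k z)) j l.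
Proof.
move=> iS; rewrite /edge (sum_wt_site r N _ iS); apply: eq_bigr => k _.
by congr (_ * _); apply: eq_bigr => z _; rewrite !(putC i).
Qed.

Definition site_mean S N f i (k : nat) : R :=
  (\sum_(z <- conf (S :\ i) (N - k)) w z * f (put i k z)) / Z (S :\ i) (N - k).

(** On the edge from [k] to [k.+1] the other sites hold [N.+1 - k] or [N - k] particles, which is
    the situation of [coupling_energy]; the particle that moves between [i] and [j] produces the
    edges at [i]. *)
Lemma site_energy S N f i : i \in S -> S :\ i != set0 -> (forall x, 0 < f x) ->
  \sum_(k < N.+1) site_wt r i k * Z (S :\ i) (N - k)
    * (Num.sqrt (site_mean S N.+1 f i k.+1) - Num.sqrt (site_mean S N.+1 f i k)) ^+ 2
  <= Delta / delta / #|S :\ i|%:R * \sum_(j in S :\ i) edge S N f i j.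
Proof.
move=> iS A0 f0; set A := S :\ i.
have -> : \sum_(j in A) edge S N f i j = \sum_(k < N.+1) site_wt r i k *
   \sum_(z <- conf A (N - k)) w z * \sum_(j in A)
     (Num.sqrt (f (put i k.+1 z)) - Num.sqrt (f (put i k (put j 1 z)))) ^+ 2.
  under eq_bigr do rewrite (edge_site N f _ _ iS); rewrite exchange_big /=.
  apply: eq_bigr => k _; rewrite -mulr_sumr; congr (_ * _).
  rewrite exchange_big /=; apply: eq_bigr => z _; rewrite -mulr_sumr; congr (_ * _).
  by apply: eq_bigr => j _; rewrite putD addn1.
rewrite mulr_sumr; apply: ler_sum => k _.
rewrite -mulrA [leRHS]mulrCA ler_wpM2l ?(ltW (site_wt_gt0 r_gt0 _ _)) //.
have kN : (k <= N)%N by rewrite -ltnS.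
rewrite /site_mean subSS (subSn kN).
exact: (@coupling_energy A (N - k) (fun z => f (put i k.+1 z)) (fun z => f (put i k z))).
Qed.

Lemma ent_site S N f i : i \in S -> S :\ i != set0 -> (forall x, 0 < f x) ->
  let nu (k : nat) := site_wt r i k * Z (S :\ i) (N - k) in
  let phi := site_mean S N f i in
  ent S N f = \sum_(k < N.+1) site_wt r i k * ent (S :\ i) (N - k) (fun z => f (put i k z))
    + (\sum_(k < N.+1) nu k * (phi k * ln (phi k)) - (\sum_(k < N.+1) nu k * phi k)
      * ln ((\sum_(k < N.+1) nu k * phi k) / \sum_(k < N.+1) nu k)).
Proof.
move=> iS A0 f0 nu phi; set A := S :\ i in A0 nu phi *.
have ZE : Z S N = \sum_(k < N.+1) nu k.
  rewrite /Zc; have := sum_wt_site r N (fun=> 1) iS.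
  under eq_bigr do rewrite mulr1; move=> ->.
  by apply: eq_bigr => k _; congr (_ * _); apply: eq_bigr => z _; rewrite mulr1.
have nuphi (k : nat) : nu k * phi k = site_wt r i k * \sum_(z <- conf A (N - k)) w z * f (put i k z).
  by rewrite /nu /phi /site_mean -/A; field; rewrite gt_eqF // Z0.
have FE : \sum_(x <- conf S N) w x * f x = \sum_(k < N.+1) nu k * phi k.
  by rewrite (sum_wt_site r N f iS); apply: eq_bigr => k _; rewrite nuphi.
rewrite {1}/ent ZE FE addrA; congr (_ - _).
rewrite (sum_wt_site r N (fun x => f x * ln (f x)) iS) -big_split /=.
apply: eq_bigr => k _; rewrite mulrA nuphi /ent -/A /phi /site_mean -/A; ring.
Qed.

Lemma ent_site_le S N f i (M : R) : i \in S -> S :\ i != set0 -> (forall x, 0 < f x) ->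
  2 <= M -> N.+2%:R <= M -> Delta * N.+1%:R * #|S :\ i|%:R <= M * delta ->
  ent S N.+1 f <= \sum_(k < N.+1) site_wt r i k
        * ent (S :\ i) (N - k).+1 (fun z => f (put i k z))
    + 20 * ln M / delta * (Delta / delta / #|S :\ i|%:R * \sum_(j in S :\ i) edge S N f i j).
Proof.
move=> iS A0 f0 M2 MN MA.
(* When all [N.+1] particles are at [i], the other sites have a single configuration and no
   entropy. *)
rewrite (ent_site _ iS A0 f0) big_ord_recr /= subnn (ent_single _ (conf0 _)) // mulr0 addr0.
apply: lerD.
  by apply: ler_sum => k _; rewrite subSn // -ltnS.
set A := S :\ i in A0 MA *.
set nu := fun k : nat => site_wt r i k * Z A (N.+1 - k).
(* Division by [delta] makes the increments of [d] at least 1. [b] is dictated by balance with [nu],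
   and decreases by [Zc_ratio_mono]. *)
pose d (k : nat) := r i k / delta.
pose b (k : nat) := if (k < N.+1)%N then Z A (N - k) / Z A (N.+1 - k) / delta else 0.
have A1 : 1 <= #|A|%:R :> R by rewrite ler1n card_gt0.
have swp (k : nat) := site_wt_gt0 r_gt0 i k.
have zp n := Z0 n A0.
have Dd : delta <= Delta by have [] := hr i 0; lra.
have Dp : 0 < Delta := lt_le_trans delta_gt0 Dd.
have nub (k : nat) : (k < N.+1)%N -> nu k * b k = site_wt r i k * Z A (N - k) / delta.
  move=> kN; rewrite /nu /b kN; field; rewrite !gt_eqF //=.
have L0 : 0 < ln M by apply: ln_gt0; lra.
have M0 : 0 < M by lra.
have := @lsi_1d R N.+1 nu d b (site_mean S N.+1 f i) M.
move=> /(_ _ _ _ _ _ _ _ _ _ M2 MN _ _ _) H.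
apply: le_trans (_ : _ <= 20 * ln M * \sum_(k < N.+1) nu k * b k *
   (Num.sqrt (site_mean S N.+1 f i k.+1) - Num.sqrt (site_mean S N.+1 f i k)) ^+ 2) _; last first.
  have -> : \sum_(k < N.+1) nu k * b k *
     (Num.sqrt (site_mean S N.+1 f i k.+1) - Num.sqrt (site_mean S N.+1 f i k)) ^+ 2
    = (\sum_(k < N.+1) site_wt r i k * Z A (N - k) *
     (Num.sqrt (site_mean S N.+1 f i k.+1) - Num.sqrt (site_mean S N.+1 f i k)) ^+ 2) / delta.
    by rewrite mulr_suml; apply: eq_bigr => k _; rewrite nub // mulrAC.
  rewrite mulrA mulrAC ler_wpM2l //; last exact: site_energy.
  by rewrite divr_ge0 ?(ltW delta_gt0) // mulr_ge0 // ltW.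
have ratio (k : nat) : (k < N.+1)%N -> (N.+1 - k = (N - k).+1)%N.
  by move=> kN; rewrite subSn // -ltnS.
have kb (k : nat) : (k < N.+1)%N -> k.+1%:R <= N.+1%:R :> R by move=> kN; rewrite ler_nat.
have dn (k : nat) : (k < N.+1)%N -> (N - k).+1%:R <= N.+1%:R :> R.
  by move=> kN; rewrite ler_nat ltnS leq_subr.
have bm (k : nat) : (k < N.+1)%N -> b k.+1 <= b k.
  move=> kN; rewrite /b kN; case: ifP => kN'; last first.
    by rewrite !divr_ge0 // ltW.
  rewrite ler_pM2r ?invr_gt0 // subSS.
  have -> : (N - k = (N - k.+1).+1)%N by rewrite subnSK.
  rewrite ratio //; have -> : (N - k = (N - k.+1).+1)%N by rewrite subnSK.
  exact: Zc_ratio_mono.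
have dS (k : nat) : d k + 1 <= d k.+1.
  rewrite /d -(divff (lt0r_neq0 delta_gt0)) -mulrDl ler_pM2r ?invr_gt0 //.
  by have [] := hr i k; lra.
apply: H.
- by move=> k _; rewrite mulr_gt0.
- move=> k kN; rewrite nub // /nu /d subSS -(site_wtS r_gt0 i k); ring.
- by move=> k kN; rewrite /b kN !divr_gt0.
- by rewrite /b ltnn.
- by move=> k _; rewrite divr_gt0 // r_gt0.
- by rewrite /d r0 mul0r.
- by move=> k _; have := dS k; lra.
- exact: bm.
- by move=> k kN; have := bm k kN; have := dS k; lra.
(* [d k.+1] is at most [Delta * N.+1%:R / delta] and [b k] at least [1 / #|A|]. For the converse
   ratio below, [b k] is at most [Delta * N.+1%:R / delta] and [d k.+1] at least 1. *)
- move=> k kN; rewrite /b /d kN mulrA ler_pM2r ?invr_gt0 //.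
  rewrite mulrA ler_pdivlMr // ratio //.
  have [h1 _] := Zc_ratio_bounds A (N - k); have [_ h2] := rate_bounds i k.+1.
  have h3 : delta * Z A (N - k).+1 <= #|A|%:R * Z A (N - k).
    apply: le_trans h1; rewrite -mulrA ler_pM2l // ler_peMl ?(ltW (zp _)) //.
    by rewrite ler1n.
  have h4 : r i k.+1 <= Delta * N.+1%:R.
    by apply: le_trans h2 _; rewrite ler_pM2l ?kb.
  rewrite -(ler_pM2l delta_gt0).
  apply: (@le_trans _ _ (Delta * N.+1%:R * (#|A|%:R * Z A (N - k)))).
    by rewrite mulrCA; apply: ler_pM => //; [exact: ltW (r_gt0 _ _)|rewrite ltW // mulr_gt0].
  by rewrite !mulrA ler_pM2r // [delta * M]mulrC.
- move=> k kN; rewrite /b /d kN mulrA ler_pM2r ?invr_gt0 //.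
  rewrite ler_pdivrMr // ratio //.
  have [_ h1] := Zc_ratio_bounds A (N - k); have [h2 _] := rate_bounds i k.+1.
  have h3 : Z A (N - k) <= Delta * N.+1%:R * Z A (N - k).+1.
    apply: (@le_trans _ _ (#|A|%:R * Z A (N - k))); first by rewrite ler_peMl // ltW.
    by apply: le_trans h1 _; rewrite ler_pM2r // ler_pM2l ?dn.
  apply: le_trans h3 _; rewrite ler_pM2r //.
  apply: (@le_trans _ _ (M * delta)).
    by apply: le_trans MA; rewrite ler_peMr // mulr_ge0 // ltW.
  rewrite ler_pM2l //; apply: le_trans h2; rewrite ler_peMr ?ler1n //; exact: ltW.
- by move=> k; rewrite divr_gt0 // sum_wt_gt0.
Qed.

Lemma ent_one_site S N f : #|S| = 1%N -> (forall x, 0 < f x) -> ent S N f = 0.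
Proof.
by move=> /eqP/cards1P[i ->] f0; apply: ent_single (conf_set1 _ _).
Qed.

(** Two distinct sites both survive the removal of [i] for [#|S| - 2] choices of [i]. *)
Lemma edges_site_sum S (e : I -> I -> R) :
  (forall i j, e i j = e j i) -> (forall i, e i i = 0) ->
  \sum_(i in S) \sum_(j in S :\ i) \sum_(l in S :\ i) e j l
  = (#|S|%:R - 2) * \sum_(i in S) \sum_(j in S) e i j.
Proof.
move=> es e0.
have D i (F : I -> R) : i \in S -> \sum_(j in S :\ i) F j = \sum_(j in S) F j - F i.
  move=> iS; rewrite [in RHS](big_setD1 i) //=; ring.
have E i : i \in S -> \sum_(j in S :\ i) \sum_(l in S :\ i) e j l
   = \sum_(j in S) \sum_(l in S) e j l - 2 * \sum_(j in S) e i j.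
  move=> iS; under eq_bigr do rewrite D //.
  have s : \sum_(j in S) e j i = \sum_(j in S) e i j by apply: eq_bigr.
  rewrite D // sumrB e0 s; ring.
rewrite (eq_bigr _ E) sumrB sumr_const -mulr_sumr -mulr_natl; ring.
Qed.

(** The constant keeps the form [C / #|S|]. Summing [ent_site_le] over the [s.+2] sites yields
    [edges S N f] taken [s] times from the smaller sets and once from the birth-death chains; the
    total [s.+1] cancels the denominator of the induction hypothesis. *)
Lemma log_sobolev_sites (M : R) (m : nat) : 2 <= M -> m.+1%:R <= M ->
  Delta * m%:R * #|I|%:R <= M * delta ->
  forall (s N : nat) S f, #|S| = s.+1 -> (N < m)%N -> (forall x, 0 < f x) ->
  ent S N.+1 f <= 20 * ln M / delta * (Delta / delta) / s.+1%:R * edges S N f.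
Proof.
move=> M2 Mm MI; elim=> [|s IH] N S f cS Nm f0.
  rewrite ent_one_site // /edges; case/cards1P: (introT eqP cS) => i ->.
  by rewrite !big_set1 edge_diag mulr0.
set C := 20 * ln M / delta * (Delta / delta).
have Dd : 0 < Delta.
  have /card_gt0P[i _] : (0 < #|S|)%N by rewrite cS.
  by have [h1 h2] := hr i 0; apply: lt_le_trans delta_gt0 (le_trans h1 h2).
have cA i : i \in S -> #|S :\ i| = s.+1.
  by move=> iS; have := cardsD1 i S; rewrite iS cS add1n => -[].
have step i : i \in S -> ent S N.+1 f <=
   C / s.+1%:R * (\sum_(j in S :\ i) \sum_(l in S :\ i) edge S N f j l
      + \sum_(j in S) edge S N f i j).
  move=> iS; have A0 : S :\ i != set0 by rewrite -card_gt0 cA.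
  apply: le_trans (@ent_site_le S N f i M iS A0 f0 M2 _ _) _.
  - by apply: le_trans Mm; rewrite ler_nat ltnS.
  - apply: le_trans MI; apply: ler_pM => //.
    + by rewrite mulr_ge0 // ltW.
    + by rewrite ler_pM2l // ler_nat.
    + by rewrite ler_nat max_card.
  rewrite mulrDr; apply: lerD; last first.
    by rewrite [in leRHS](big_setD1 i) //= edge_diag add0r cA // /C !mulrA.
  have -> : \sum_(j in S :\ i) \sum_(l in S :\ i) edge S N f j l
     = \sum_(k < N.+1) site_wt r i k * edges (S :\ i) (N - k) (fun z => f (put i k z)).
    under eq_bigr do under eq_bigr do rewrite (edge_site N f _ _ iS).
    under eq_bigr do rewrite exchange_big /=.
    rewrite exchange_big /=; apply: eq_bigr => k _.
    by rewrite /edges mulr_sumr; apply: eq_bigr => j _; rewrite mulr_sumr.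
  rewrite mulr_sumr; apply: ler_sum => k _; rewrite mulrCA.
  rewrite ler_wpM2l ?(ltW (site_wt_gt0 r_gt0 _ _)) //.
  apply: IH => //; first exact: cA.
  exact: leq_ltn_trans (leq_subr _ _) Nm.
have sp : 0 < s.+1%:R :> R by rewrite ltr0n.
have sp2 : 0 < s.+2%:R :> R by rewrite ltr0n.
have tot : s.+2%:R * ent S N.+1 f <= C * edges S N f.
  rewrite -cS mulr_natl -sumr_const.
  apply: le_trans (ler_sum _ step) _; rewrite -mulr_sumr big_split /=.
  rewrite edges_site_sum; [|exact: edge_sym|exact: edge_diag].
  rewrite -/(edges S N f) cS.
  have -> : (s.+2%:R - 2) * edges S N f + edges S N f = s.+1%:R * edges S N f.
    by rewrite -!natr1; ring.
  by rewrite mulrA divfK // gt_eqF.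
by rewrite mulrAC ler_pdivlMr // mulrC.
Qed.

End Recursion.

(** * The zero-range process *)

Section Attained.
Variables (R : realType) (T : finType) (Q : T -> T -> R) (pi : T -> R).

(** The infimum of the admissible constants is admissible: for each [f] the inequality is a lower
    bound on the constant, or does not involve it when the Dirichlet form vanishes. *)
Lemma log_sobolev_constant_exists (t : R) :
  (forall f, (forall x, 0 < f x) ->
    0 <= dirichlet Q pi (fun x => Num.sqrt (f x)) (fun x => Num.sqrt (f x))) ->
  0 <= t -> log_sobolev_ineq Q pi t ->
  exists2 s, is_log_sobolev_constant Q pi s & s <= t.
Proof.
move=> D0 t0 ht; pose A (s : R) := 0 <= s /\ log_sobolev_ineq Q pi s.
have At : A t by [].
have A0 : classical_sets.lbound A 0 by move=> s [].
have hA : classical_sets.has_lbound A by exists 0.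
exists (inf A); last exact: ge_inf.
split; first by apply: lb_le_inf => //; exists t.
  move=> f f0; have := D0 f f0.
  set D := dirichlet _ _ _ _; rewrite le0r => /orP[/eqP e|Dp].
    by have := ht f f0; rewrite -/D e !mulr0.
  rewrite -ler_pdivrMr //; apply: lb_le_inf; first by exists t.
  by move=> s [_ /(_ f f0)]; rewrite ler_pdivrMr.
by move=> s s0 hs; apply: ge_inf.
Qed.

End Attained.

(** * Identification with the process on [zrp_state] *)

Section ZeroRangeProcess.
Variables (R : realType) (m n : nat).
Variable r : 'I_n -> nat -> R.
Hypothesis r0 : forall i, r i 0%N = 0.
Hypothesis r_gt0 : forall i k, (1 <= k)%N -> 0 < r i k.

Local Notation state := (zrp_state m n).

Definition occs (x : state) : {ffun 'I_n -> nat} := [ffun i => occ x i].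

Lemma occs_inj : injective occs.
Proof.
move=> x y /ffunP e; apply/val_inj/ffunP => i; apply/val_inj.
by have := e i; rewrite !ffunE.
Qed.

Lemma sum_state (F : {ffun 'I_n -> nat} -> R) :
  \sum_(x : state) F (occs x) = \sum_(y <- conf [set: 'I_n] m) F y.
Proof.
rewrite -(big_map occs predT F); apply: perm_big; apply: uniq_perm.
- by rewrite map_inj_uniq ?index_enum_uniq //; exact: occs_inj.
- exact: conf_uniq.
move=> y; rewrite mem_conf; apply/mapP/andP => [[x _ ->]|[/eqP sy _]].
  split; last by apply/forallP => i; rewrite inE.
  under eq_bigr do rewrite ffunE; exact: (valP x).
have yi i : (y i < m.+1)%N by rewrite ltnS -sy (bigD1 i) //= leq_addr.
have yP : (\sum_(i < n) ([ffun i => Ordinal (yi i)] : {ffun 'I_n -> 'I_m.+1}) i)%N == m.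
  by apply/eqP; rewrite -[RHS]sy; apply: eq_bigr => i _; rewrite ffunE.
exists (exist (fun x : {ffun 'I_n -> 'I_m.+1} => \sum_(i < n) x i == m)%N _ yP : state).
  by rewrite mem_index_enum.
by apply/ffunP => i; rewrite ffunE /occ /= ffunE.
Qed.

Lemma zrp_weightE (x : state) : zrp_weight r x = wt r (occs x).
Proof. by apply: eq_bigr => i _; rewrite ffunE. Qed.

Lemma mean_zrp (F : {ffun 'I_n -> nat} -> R) :
  mean (@zrp_measure R m n r) (fun x => F (occs x))
  = (\sum_(y <- conf [set: 'I_n] m) wt r y * F y) / Zc r [set: 'I_n] m.
Proof.
rewrite /mean /zrp_measure (eq_bigr _ (fun x _ => zrp_weightE x)) -/(state).
rewrite (sum_state (wt r)) -/(Zc _ _ _) mulr_suml -(sum_state (fun y => wt r y * F y / _)).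
by apply: eq_bigr => x _; rewrite zrp_weightE mulrAC.
Qed.

Lemma entropy_zrp (F : {ffun 'I_n -> nat} -> R) :
  entropy (@zrp_measure R m n r) (fun x => F (occs x))
  = ent r [set: 'I_n] m F / Zc r [set: 'I_n] m.
Proof.
rewrite /entropy /ent (mean_zrp F) (mean_zrp (fun y => F y * ln (F y))) mulrBl.
by congr (_ - _); rewrite mulrAC.
Qed.

Lemma occs_jump (x : state) i j : (0 < occ x i)%N ->
  occs (zrp_move x i j) = jump i j (occs x).
Proof.
move=> xi; apply/ffunP => k; have := occ_zrp_move j k xi; rewrite !ffunE mul1n.
case: (eqVneq k i) => [->|_]; last by rewrite addn0 subn0.
move: (occ x i) xi (occ (zrp_move x i j) i) (nat_of_bool (i == j)) => a a0 b c /= e.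
lia.
Qed.

Lemma dirichlet_zrp (G : 'M[R]_n) (F : {ffun 'I_n -> nat} -> R) :
  (forall i j, G i j = n%:R^-1) -> (0 < m)%N ->
  dirichlet (kernel_of (@zrp_generator R m n r G)) (@zrp_measure R m n r)
    (fun x => Num.sqrt (F (occs x))) (fun x => Num.sqrt (F (occs x)))
  = 2^-1 * (n%:R^-1 * edges r [set: 'I_n] m.-1 F / Zc r [set: 'I_n] m).
Proof.
move=> hG m0; rewrite /dirichlet; congr (_ * _).
pose a y := Num.sqrt (F y); set Z := Zc _ _ _.
have inner (x : state) :
  \sum_(y : state) zrp_measure r x * kernel_of (@zrp_generator R m n r G) x y
      * (a (occs x) - a (occs y)) * (a (occs x) - a (occs y))
  = (\sum_(i < n) \sum_(j < n)
      wt r (occs x) * (r i (occs x i) * (a (occs x) - a (jump i j (occs x))) ^+ 2)) / n%:R / Z.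
  pose D (y : state) := (a (occs x) - a (occs y)) ^+ 2.
  transitivity (zrp_measure r x * \sum_(i < n) \sum_(j < n) r i (occ x i) * n%:R^-1
      * \sum_(y : state) ((zrp_move x i j == y)%:R - (x == y)%:R) * D y).
    rewrite (eq_bigr (fun y => zrp_measure r x *
      (kernel_of (@zrp_generator R m n r G) x y * D y))); last first.
      by move=> y _; rewrite /D; ring.
    rewrite -mulr_sumr; congr (_ * _).
    under eq_bigr do rewrite /kernel_of /zrp_generator mulr_suml.
    rewrite exchange_big /=; apply: eq_bigr => i _.
    under eq_bigr do rewrite mulr_suml.
    rewrite exchange_big /=; apply: eq_bigr => j _.
    rewrite mulr_sumr; apply: eq_bigr => y _; rewrite hG /D; ring.
  rewrite /zrp_measure (eq_bigr _ (fun x _ => zrp_weightE x)) (sum_state (wt r)).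
  rewrite -/(Zc _ _ _) -/Z zrp_weightE mulrAC; congr (_ / _).
  rewrite mulr_suml mulr_sumr; apply: eq_bigr => i _.
  rewrite mulr_suml mulr_sumr; apply: eq_bigr => j _.
  (* The diagonal part of the kernel contributes [D x], which is 0. *)
  have -> : \sum_(y : state) ((zrp_move x i j == y)%:R - (x == y)%:R) * D y
      = D (zrp_move x i j).
    under eq_bigr do rewrite mulrBl; rewrite sumrB.
    rewrite !sum_indicator ?index_enum_uniq ?mem_index_enum //.
    by rewrite {2}/D subrr expr0n subr0.
  (* At an empty site the rate vanishes, whatever [zrp_move] returns. *)
  rewrite ffunE; have [->|xi] := posnP (occ x i); first by rewrite r0 !mul0r mulr0 mul0r.
  by rewrite /D occs_jump //; ring.
under eq_bigr do rewrite inner.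
rewrite -!mulr_suml (sum_state (fun y => \sum_(i < n) \sum_(j < n)
  wt r y * (r i (y i) * (a y - a (jump i j y)) ^+ 2))).
rewrite [n%:R^-1 * _]mulrC; congr (_ / _ / _).
rewrite exchange_big /=; apply: eq_big => [i|i _]; first by rewrite inE.
rewrite exchange_big /=; apply: eq_big => [j|j _]; first by rewrite inE.
rewrite -(prednK m0) (sum_wt_put r0 r_gt0 m.-1 (fun y => (a y - a (jump i j y)) ^+ 2)) ?inE //.
by apply: eq_bigr => z _; rewrite jump_put.
Qed.

(** The value 1 away from the image of [occs] preserves positivity. *)
Definition on_conf (f : state -> R) (y : {ffun 'I_n -> nat}) : R :=
  if [pick x | occs x == y] is Some x then f x else 1.

Lemma on_confE f x : on_conf f (occs x) = f x.
Proof.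
rewrite /on_conf; case: pickP => [x' /eqP/occs_inj -> //|/(_ x)].
by rewrite eqxx.
Qed.

Lemma on_conf_gt0 f y : (forall x, 0 < f x) -> 0 < on_conf f y.
Proof. by move=> f0; rewrite /on_conf; case: pickP. Qed.

End ZeroRangeProcess.

Theorem corollary2 (R : realType) (m n : nat) (hm : (1 <= m)%N) (hn : (1 <= n)%N)
    (G : 'M[R]_n) (hG : forall i j : 'I_n, G i j = n%:R^-1)
    (r : 'I_n -> nat -> R)
    (r_ge0 : forall (i : 'I_n) (k : nat), 0 <= r i k)
    (r0 : forall i : 'I_n, r i 0%N = 0)
    (r_gt0 : forall (i : 'I_n) (k : nat), (1 <= k)%N -> 0 < r i k)
    (delta Delta : R) (delta_gt0 : 0 < delta) (Delta_gt0 : 0 < Delta)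
    (hr : forall (i : 'I_n) (k : nat),
        delta <= r i k.+1 - r i k /\ r i k.+1 - r i k <= Delta) :
  exists2 tLS : R,
    is_log_sobolev_constant
      (kernel_of (@zrp_generator R m n r G)) (@zrp_measure R m n r) tLS
    & tLS <= 40%:R * Delta / delta ^+ 2 * ln (Delta * m%:R * n%:R / delta).
Proof.
have n1 : 1 <= n%:R :> R by rewrite ler1n.
have m1 : 1 <= m%:R :> R by rewrite ler1n.
have np : 0 < n%:R :> R by rewrite ltr0n.
have T0 : [set: 'I_n] != set0 by rewrite -card_gt0 cardsT card_ord.
have Zp := Zc_gt0 r_gt0 m T0.
have Dd : 1 <= Delta / delta.
  rewrite ler_pdivlMr // mul1r.
  by have [h1 h2] := hr (Ordinal hn) 0; apply: le_trans h1 h2.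
set M := Delta * m%:R * n%:R / delta.
have ME : M = Delta / delta * (m%:R * n%:R) by rewrite /M; field; rewrite gt_eqF.
have mn : 1 <= m%:R * n%:R :> R by rewrite -natrM ler1n muln_gt0 hm.
have M1 : 1 <= M by rewrite ME mulr_ege1.
have C0 : 0 <= 40%:R * Delta / delta ^+ 2 * ln M.
  by rewrite mulr_ge0 ?ln_ge0 // divr_ge0 ?sqr_ge0 // mulr_ge0 // ltW.
have edges_ge0 F : 0 <= edges r [set: 'I_n] m.-1 F.
  apply: sumr_ge0 => i _; apply: sumr_ge0 => j _; apply: sumr_ge0 => z _.
  by rewrite mulr_ge0 ?sqr_ge0 // ltW // wt_gt0.
have entE (f : zrp_state m n -> R) : entropy (@zrp_measure R m n r) f
    = ent r [set: 'I_n] m (on_conf f) / Zc r [set: 'I_n] m.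
  by rewrite -entropy_zrp; congr entropy; apply: boolp.funext => x; rewrite on_confE.
have dirE (f : zrp_state m n -> R) :
    dirichlet (kernel_of (@zrp_generator R m n r G)) (@zrp_measure R m n r)
      (fun x => Num.sqrt (f x)) (fun x => Num.sqrt (f x))
    = 2^-1 * (n%:R^-1 * edges r [set: 'I_n] m.-1 (on_conf f) / Zc r [set: 'I_n] m).
  rewrite -(dirichlet_zrp r0 r_gt0 _ hG hm); congr dirichlet;
  by apply: boolp.funext => x; rewrite on_confE.
have dir0 f : (forall x, 0 < f x) -> 0 <= dirichlet (kernel_of (@zrp_generator R m n r G))
    (@zrp_measure R m n r) (fun x => Num.sqrt (f x)) (fun x => Num.sqrt (f x)).
  move=> f0; rewrite dirE mulr_ge0 ?invr_ge0 // divr_ge0 ?(ltW Zp) //.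
  by rewrite mulr_ge0 ?invr_ge0.
apply: log_sobolev_constant_exists => // f f0.
have g0 y : 0 < on_conf f y by exact: on_conf_gt0.
(* A single site is treated apart: its entropy is 0, whereas [M] may be less than 2. From two sites
   on, [m * n] is at least 2 and at least [m.+1]. *)
case: (posnP n.-1) => n2.
  have T1 : #|[set: 'I_n]| = 1%N by rewrite cardsT card_ord; case: (n) hn n2 => [|[|?]].
  by rewrite entE (ent_one_site r_gt0 m T1 g0) mul0r mulr_ge0 ?dir0.
have nn : (2 <= n)%N by lia.
have mn2 : (2 <= m * n)%N by apply: leq_trans nn _; rewrite leq_pmull.
have mn1 : (m.+1 <= m * n)%N.
  by apply: leq_trans (_ : m * 2 <= _)%N; [lia | rewrite leq_mul2l nn orbT].
have le_M k : (k <= m * n)%N -> k%:R <= M.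
  move=> km; rewrite ME -natrM; apply: le_trans (_ : (m * n)%:R <= _); first by rewrite ler_nat.
  by rewrite ler_peMl.
have := @log_sobolev_sites _ _ r r0 r_gt0 _ _ delta_gt0 hr M m (le_M 2 mn2) (le_M m.+1 mn1) _
  n.-1 m.-1 [set: 'I_n] (on_conf f).
rewrite cardsT card_ord !prednK // => H.
rewrite entE dirE; set E := edges _ _ _ _ in H *.
(* 40 becomes 20 through the factor 1/2 of the Dirichlet form, and [1 / n] is the entry of [G]. *)
rewrite (_ : _ * (_ * _) = 20 * ln M / delta * (Delta / delta) / n%:R * E
    / Zc r [set: 'I_n] m); last by field; rewrite !gt_eqF.
rewrite ler_pM2r ?invr_gt0 //.
apply: H => //.
by rewrite /M divfK // gt_eqF.
Qed.
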